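(* Let $\kappa\in(0,\infty)$, let $c\geq 3$ and let $$\Lambda:(\mathscr{C}(\mathbb{E}^{c}),\wedge,\vee)\to(Cvx^{\kappa}_{(0,0)}(\mathbb{E}^{c}),\sqcap_{-},\sqcup_{-})$$ be a non-trivial lattice anti-homomorphism, i.e. $\Lambda(C\wedge D)=\Lambda(C)\sqcup_{-}\Lambda(D)$ and $\Lambda(C\vee D)=\Lambda(C)\sqcap_{-}\Lambda(D)$ for all $C,D\in\mathscr{C}(\mathbb{E}^{c})$, and $\Lambda$ is not constant. Then there exists an affine bijection $\phi:\mathbb{E}^{c}\to\mathbb{E}^{c}$ such that $\Lambda(C)=\mathcal{L}[1^{\infty}_{\phi(C)}]$ for all $C\in\mathscr{C}(\mathbb{E}^{c})$, where $\mathcal{L}$ denotes the Legendre-Fenchel transformation.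
   Context: $\mathbb{E}^{c}$ is $c$-dimensional Euclidean space with inner product $\langle\cdot|\cdot\rangle$; $\mathscr{C}(\mathbb{E}^{c})$ is the lattice of all compact convex subsets of $\mathbb{E}^{c}$, including $\emptyset$, with $C\wedge D=C\cap D$, $C\vee D=\operatorname{conv}(C\cup D)$. $Cvx(\mathbb{E}^{c})$ is the set of all lower semi-continuous convex functions $f:\mathbb{E}^{c}\to(-\infty,\infty]$ together with the constant function $-\infty$. Let $Cvx_{(0,0)}(\mathbb{E}^{c})=\{f\in Cvx(\mathbb{E}^{c})\mid f(0)=0\}\cup\{-\infty\}$, where $-\infty$ is the constant function. For $f,g\in Cvx_{(0,0)}(\mathbb{E}^{c})$ let $f\sqcap_{-}g=\min\{h\in Cvx_{(0,0)}(\mathbb{E}^{c})\mid f,g\leq h\}$ and $f\sqcup_{-}g=\max\{h\in Cvx_{(0,0)}(\mathbb{E}^{c})\mid f,g\geq h\}$, where $\min$, $\max$ are the least and greatest elements with respect to the pointwise order (they exist). For a compact convex $C\subseteq\mathbb{E}^{c}$ let $h_{C}(y)=\sup_{x\in C}\langle x|y\rangle$ be its support function (so $h_{\emptyset}=-\infty$), and let $\mathcal{S}(\mathbb{E}^{c})$ be the set of all such $h_{C}$. For $\kappa\in(0,\infty)$, $$Cvx^{\kappa}_{(0,0)}(\mathbb{E}^{c})=\{g\in Cvx_{(0,0)}(\mathbb{E}^{c})\mid\exists h\in\mathcal{S}(\mathbb{E}^{c})\text{ such that }h-\kappa\leq g\leq h\}.$$ For $C\subseteq\mathbb{E}^{c}$,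 $1^{\infty}_{C}$ is the function equal to $0$ on $C$ and $\infty$ off $C$. The Legendre-Fenchel transform is $[\mathcal{L}f](y)=\sup_{x\in\mathbb{E}^{c}}(\langle x|y\rangle-f(x))$ for $f\in Cvx(\mathbb{E}^{c})$. *)

(* Defs.v *)
From HB Require Import structures.
From mathcomp Require Import all_boot all_order all_algebra.
From mathcomp Require Import mathcomp_extra boolp classical_sets functions reals.
From mathcomp Require Import ereal interval_inference topology normedtype convex.

Set Implicit Arguments.
Unset Strict Implicit.
Unset Printing Implicit Defensive.

Import Order.TTheory GRing.Theory Num.Theory.
Import numFieldNormedType.Exports.

Local Open Scope classical_set_scope.
Local Open Scope ring_scope.

(* E^c is 'rV[R]_c. Its library topology is that of the sup norm, i.e. the
   Euclidean one. *)
Definition dotp (R : realType) (c : nat) (x y : 'rV[R]_c) : R :=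
  \sum_(i < c) x 0 i * y 0 i.

(* The empty set is included. *)
Definition compact_convex (R : realType) (c : nat) : set (set 'rV[R]_c) :=
  [set C : set 'rV[R]_c | compact C /\ convex_set C].

Definition conv_hull (R : realType) (c : nat) (A : set 'rV[R]_c) :
    set 'rV[R]_c :=
  smallest (fun B : set 'rV[R]_c => convex_set B) A.

Definition econvex (R : realType) (c : nat) (f : 'rV[R]_c -> \bar R) : Prop :=
  forall (x y : 'rV[R]_c) (t : R), 0 < t -> t < 1 ->
    (f (t *: x + (1 - t) *: y)%R <= t%:E * f x + (1 - t)%:E * f y)%E.

Definition ninfty_fun (R : realType) (c : nat) : 'rV[R]_c -> \bar R :=
  fun=> -oo%E.

Definition Cvx (R : realType) (c : nat) : set ('rV[R]_c -> \bar R) :=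
  [set f | (forall x, (-oo < f x)%E) /\ lower_semicontinuous f /\ econvex f]
  `|` [set @ninfty_fun R c].

Definition Cvx00 (R : realType) (c : nat) : set ('rV[R]_c -> \bar R) :=
  [set f | Cvx f /\ f 0 = 0%E] `|` [set @ninfty_fun R c].

(* On functions, (_ <= _)%O is the pointwise order. *)
Definition least (d : Order.disp_t) (T : porderType d) (A : set T) : set T :=
  A `&` lbound A.

Definition greatest (d : Order.disp_t) (T : porderType d) (A : set T) : set T :=
  A `&` ubound A.

(* The default value of xget is never used on Cvx00: see sqcapP and sqcupP. *)
Definition sqcap (R : realType) (c : nat) (f g : 'rV[R]_c -> \bar R) :
    'rV[R]_c -> \bar R :=
  xget (@ninfty_fun R c)
    (least [set h | Cvx00 h /\ (f <= h)%O /\ (g <= h)%O]).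

Definition sqcup (R : realType) (c : nat) (f g : 'rV[R]_c -> \bar R) :
    'rV[R]_c -> \bar R :=
  xget (@ninfty_fun R c)
    (greatest [set h | Cvx00 h /\ (h <= f)%O /\ (h <= g)%O]).

Definition support_fun (R : realType) (c : nat) (C : set 'rV[R]_c) :
    'rV[R]_c -> \bar R :=
  fun y => ereal_sup [set (dotp x y)%:E | x in C].

Definition support_funs (R : realType) (c : nat) : set ('rV[R]_c -> \bar R) :=
  [set support_fun C | C in @compact_convex R c].

Definition Cvx00_near (R : realType) (c : nat) (kappa : R) :
    set ('rV[R]_c -> \bar R) :=
  [set g | Cvx00 g /\ exists2 h, support_funs h &
     forall x, (h x - kappa%:E <= g x)%E /\ (g x <= h x)%E].

Definition indic_infty (R : realType) (c : nat) (C : set 'rV[R]_c) :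
    'rV[R]_c -> \bar R :=
  fun x => if x \in C then 0%E else +oo%E.

Definition legendre (R : realType) (c : nat) (f : 'rV[R]_c -> \bar R) :
    'rV[R]_c -> \bar R :=
  fun y => ereal_sup (range (fun x => (dotp x y)%:E - f x)%E).

Definition is_affine (R : realType) (c : nat) (phi : 'rV[R]_c -> 'rV[R]_c) :
    Prop :=
  exists (L : {linear 'rV[R]_c -> 'rV[R]_c}) (b : 'rV[R]_c),
    forall x, phi x = L x + b.

Lemma Cvx00_sup (R : realType) (c : nat) (A : set ('rV[R]_c -> \bar R)) :
  A `<=` @Cvx00 R c -> Cvx00 (fun x => ereal_sup [set h x | h in A]).
Proof.
move=> sA; set F := fun x => _.
have leF h x : A h -> (h x <= F x)%E.
  by move=> Ah; apply: ereal_sup_ubound; exists h.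
have [[h [Ah hN]]|noh] := pselect (exists h, A h /\ h <> @ninfty_fun R c);
  last first.
  right; apply/funext => x; apply/ereal_sup_ninfty => _ [h Ah <-] /=.
  by have [->//|hN] := pselect (h = @ninfty_fun R c); case: noh; exists h.
have propA k : A k -> k <> @ninfty_fun R c ->
    (forall x, (-oo < k x)%E) /\ lower_semicontinuous k /\ econvex k /\
    k 0 = 0%E.
  move=> Ak kN; case: (sA _ Ak) => [[[[k1 [k2 k3]]|//] k0]|//].
  by split.
have [h1 [_ [_ h0]]] := propA _ Ah hN.
have Fgt x : (-oo < F x)%E by apply: lt_le_trans (h1 x) (leF _ _ Ah).
left; split; last first.
  apply/eqP; rewrite eq_le; apply/andP; split; last by rewrite -h0; exact: leF.
  apply: ge_ereal_sup => _ [k Ak <-].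
  have [->|kN] := pselect (k = @ninfty_fun R c); first exact: leNye.
  by have [_ [_ [_ ->]]] := propA _ Ak kN.
left; split=> //; split.
  move=> x a /ereal_sup_gt[_ [k Ak <-]] ak.
  have kN : k <> @ninfty_fun R c by move=> kE; move: ak; rewrite kE.
  have [_ [/(_ x a ak) [V xV Va] _]] := propA _ Ak kN.
  by exists V => // y /Va /lt_le_trans; apply; exact: leF.
move=> x y t t0 t1; apply: ge_ereal_sup => _ [k Ak <-].
have [->|kN] := pselect (k = @ninfty_fun R c); first exact: leNye.
have [_ [_ [/(_ x y t t0 t1) kc _]]] := propA _ Ak kN.
apply: le_trans kc _; apply: leeD; apply: lee_wpmul2l; rewrite ?lee_fin.
- exact: ltW.
- exact: leF.
- by rewrite subr_ge0 ltW.
- exact: leF.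
Qed.

Lemma sqcapP (R : realType) (c : nat) (f g : 'rV[R]_c -> \bar R) :
  Cvx00 f -> Cvx00 g ->
  least [set h | Cvx00 h /\ (f <= h)%O /\ (g <= h)%O] (sqcap f g).
Proof.
move=> Cf Cg; rewrite /sqcap; case: xgetP => // /(_ _) no_least.
case: (no_least (fun x => ereal_sup [set h x | h in [set f; g]])); split.
  split; first by apply: Cvx00_sup => h [] ->.
  by split; apply/lefP => x; apply: ereal_sup_ubound => /=;
    [exists f => //; left|exists g => //; right].
move=> h [_ [/lefP fh /lefP gh]]; apply/lefP => x.
by apply: ge_ereal_sup => _ [k [] -> <-].
Qed.

Lemma sqcupP (R : realType) (c : nat) (f g : 'rV[R]_c -> \bar R) :
  greatest [set h | Cvx00 h /\ (h <= f)%O /\ (h <= g)%O] (sqcup f g).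
Proof.
rewrite /sqcup; set A := [set h | _]; case: xgetP => // /(_ _) no_greatest.
case: (no_greatest (fun x => ereal_sup [set h x | h in A])); split.
  split; first by apply: Cvx00_sup => h [].
  by split; apply/lefP => x; apply: ge_ereal_sup => _ [k [_ [/lefP kf /lefP kg]] <-].
by move=> h Ah; apply/lefP => x; apply: ereal_sup_ubound; exists h.
Qed.

(* Main.v *)
(* In the pointwise order, [Lambda] preserves meets and joins.  Passing to
   Legendre conjugates, [conj_epi C] is the epigraph of the conjugate of
   [Lambda C] and [conj_zero C] its zero level set (the subdifferential of
   [Lambda C] at 0).  Zero level sets always commute with intersections, and so
   do epigraphs as soon as the zero level sets have a common point.

   If [Lambda set0] is not [-oo], the conjugates all have a common zero.  The
   parts of the epigraphs [conj_epi [set x]] outside [conj_epi set0] are then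
   pairwise disjoint.  If [conj_epi set0] has interior, they contain points with
   rational coordinates, so that only countably many of them are nonempty; if
   it lies in a vertical hyperplane, Radon's theorem in a slice of codimension 2
   excludes c + 1 affinely independent [x] for which they are nonempty.  As the
   exceptional [x] form the complement of a convex set, there are none, and
   [Lambda] is constant.

   If [Lambda set0] is [-oo], the sets [conj_zero [set x]] are disjoint and, by
   Radon's theorem again, selections of them preserve affine independence.  If
   such a set had two points, its tangent cone at each of its points would be the
   whole space, which is absurd for a closed set that is not everything; so it
   is a singleton [[set phi x]].  The map [phi] preserves betweenness and
   noncollinearity; concurrence of medians shows that it maps midpoints to
   weighted midpoints whose weights are affine and positive, hence constant, so
   [phi] is affine.  Finally all epigraphs have to be vertical half-lines, since
   otherwise the slopes of [Lambda [set x]] would be unbounded. *)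

Require Import Defs.
From mathcomp Require Import all_boot all_order all_algebra.
From mathcomp Require Import ring lra.
From mathcomp Require Import boolp classical_sets functions cardinality reals.
From mathcomp Require Import ereal interval_inference topology normedtype.
From mathcomp Require Import convex measure lebesgue_measure.

Set Implicit Arguments.
Unset Strict Implicit.
Unset Printing Implicit Defensive.

Import Order.TTheory GRing.Theory Num.Theory.
Import numFieldNormedType.Exports.

Local Open Scope classical_set_scope.
Local Open Scope ring_scope.

(** * Coordinates and the inner product *)

Lemma rV_neq0 (R : realType) (n : nat) (v : 'rV[R]_n) :
  v <> 0 -> exists i, v 0 i != 0.
Proof.
move=> vn; apply: contrapT => /forallNP h; apply: vn; apply/rowP => i.
by rewrite mxE; have /negP := h i; rewrite negbK => /eqP.
Qed.

Lemma ord_neq (n : nat) (i : 'I_n) : (2 <= n)%N -> exists j : 'I_n, j != i.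
Proof.
move=> n2; have [i0|i0] := eqVneq (val i) 0%N.
  by exists (Ordinal n2); rewrite -val_eqE /= i0.
by exists (Ordinal (ltnW n2)); rewrite -val_eqE /= eq_sym.
Qed.

Section dotp_theory.
Context {R : realType} {n : nat}.
Implicit Types x y z : 'rV[R]_n.

Lemma dotpC x y : dotp x y = dotp y x.
Proof. by apply: eq_bigr => i _; rewrite mulrC. Qed.

Lemma dotpDl x y z : dotp (x + y) z = dotp x z + dotp y z.
Proof. by rewrite -big_split; apply: eq_bigr => i _ /=; rewrite mxE mulrDl. Qed.

Lemma dotpZl (a : R) x z : dotp (a *: x) z = a * dotp x z.
Proof. by rewrite mulr_sumr; apply: eq_bigr => i _ /=; rewrite mxE mulrA. Qed.

Lemma dotpNl x z : dotp (- x) z = - dotp x z.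
Proof. by rewrite -scaleN1r dotpZl mulN1r. Qed.

Lemma dotpDr x y z : dotp z (x + y) = dotp z x + dotp z y.
Proof. by rewrite dotpC dotpDl 2!(dotpC z). Qed.

Lemma dotpZr (a : R) x z : dotp z (a *: x) = a * dotp z x.
Proof. by rewrite dotpC dotpZl (dotpC z). Qed.

Lemma dotpNr x z : dotp z (- x) = - dotp z x.
Proof. by rewrite dotpC dotpNl (dotpC z). Qed.

Lemma dotp0l z : dotp 0 z = 0.
Proof. by rewrite -(scale0r 0) dotpZl mul0r. Qed.

Lemma dotp0r z : dotp z 0 = 0.
Proof. by rewrite dotpC dotp0l. Qed.

Definition dotpE := (dotpDl, dotpDr, dotpNl, dotpNr, dotpZl, dotpZr, dotp0l, dotp0r).

Lemma dotp_sumr (I : finType) (P : pred I) (F : I -> 'rV[R]_n) z :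
  dotp z (\sum_(i | P i) F i) = \sum_(i | P i) dotp z (F i).
Proof.
elim/big_rec2: _ => [|i y1 y2 _ <-]; first exact: dotp0r.
by rewrite dotpDr.
Qed.

Lemma dotp_delta x i : dotp x (delta_mx 0 i) = x 0 i.
Proof.
rewrite /dotp (bigD1 i) //= mxE !eqxx mulr1 big1 ?addr0 // => j /negPf ji.
by rewrite mxE ji andbF mulr0.
Qed.

Lemma dotp_eq0 x : dotp x x = 0 -> x = 0.
Proof.
move=> x0; apply/rowP => i; rewrite mxE.
have /eqP : \sum_(i < n) x 0 i * x 0 i = 0 by [].
rewrite psumr_eq0 => [/allP /(_ i)|j _]; last exact: sqr_ge0.
by rewrite mem_index_enum => /(_ isT) /=; rewrite -expr2 sqrf_eq0 => /eqP.
Qed.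

Lemma dotp_ge0 x : 0 <= dotp x x.
Proof. by apply: sumr_ge0 => i _; rewrite -expr2 sqr_ge0. Qed.

Lemma dotp_mx x y : x *m y^T = (dotp x y)%:M.
Proof.
apply/matrixP => i j; rewrite !ord1 !mxE eqxx mulr1n.
by apply: eq_bigr => k _; rewrite mxE.
Qed.

End dotp_theory.

(** * Convex combinations in a real vector space *)

Section convexity.
Context {R : realType} {V : lmodType R}.

(** The weight [t] sits on the second point, so that [t] runs along the segment from [x] to [y]. *)
Definition cvx (A : set V) := forall x y t,
  A x -> A y -> 0 <= t -> t <= 1 -> A ((1 - t) *: x + t *: y).

Lemma cvxI (A B : set V) : cvx A -> cvx B -> cvx (A `&` B).
Proof. by move=> cA cB x y t [? ?] [? ?] ? ?; split; [apply: cA|apply: cB]. Qed.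

Lemma convex_setE (A : set V) : convex_set A <-> cvx A.
Proof.
have E (l : {i01 R}) (x y : convex_lmodType V) :
  conv l x y = l%:num *: (x : V) + (1 - l%:num) *: (y : V) by [].
split=> cA x y t.
  move=> /mem_set Ax /mem_set Ay t0 t1.
  have t1' : 1 - t <= 1 by lra.
  have t0' : 0 <= 1 - t by lra.
  by have := cA _ _ (Itv01 t0' t1') Ax Ay; rewrite inE E /= subKr.
rewrite !inE E => Ax Ay; rewrite addrC.
by apply: cA.
Qed.

Lemma cvx_sum (A : set V) (I : finType) (P : pred I) (a : I -> R) (x : I -> V) :
  cvx A -> (forall i, P i -> 0 <= a i) -> (forall i, P i -> A (x i)) ->
  \sum_(i | P i) a i = 1 -> A (\sum_(i | P i) a i *: x i).
Proof.
move=> cA a0 Ax a1.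
(* Sublists are normalised by their total weight, which has to be positive; a tail of total weight 0
   has only zero terms. *)
have key (s : seq I) : (0 < \sum_(i <- s | P i) a i ->
    A ((\sum_(i <- s | P i) a i)^-1 *: \sum_(i <- s | P i) a i *: x i)).
  elim: s => [|i s IH]; first by rewrite big_nil ltxx.
  rewrite !big_cons; case: ifP => // Pi; set S := \sum_(j <- s | _) a j.
  set X := \sum_(j <- s | _) _ => S0.
  have Sge : 0 <= S by apply: sumr_ge0.
  have [S00|S00] := eqVneq S 0.
    have X0 : X = 0.
      rewrite /X big_seq_cond; apply: big1 => j /andP[js Pj].
      have /eqP := S00; rewrite /S psumr_eq0 // => /allP /(_ _ js) /implyP /(_ Pj).
      by move=> /eqP ->; rewrite scale0r.
    rewrite X0 S00 !addr0 in S0 *.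
    by rewrite scalerA mulVf ?scale1r; [exact: Ax|exact: lt0r_neq0].
  have Sgt : 0 < S by rewrite lt_neqAle eq_sym S00.
  have ai0 := a0 _ Pi.
  have n0 : a i + S != 0 by exact: lt0r_neq0.
  have -> : (a i + S)^-1 *: (a i *: x i + X) =
      (1 - S / (a i + S)) *: x i + (S / (a i + S)) *: (S^-1 *: X).
    rewrite scalerDr !scalerA; congr (_ *: _ + _ *: _); [by field|].
    by field; rewrite S00.
  apply: cA; [exact: Ax|exact: IH|by rewrite divr_ge0 // ltW|].
  by rewrite ler_pdivrMr // mul1r lerDr.
have := key (index_enum I); rewrite a1 invr1 scale1r; apply; exact: ltr01.
Qed.

End convexity.

(** * Hahn-Banach and subgradients *)

Section hahn_banach.
Context {R : realType}.

(* The convex set [E] stands for the epigraph of a convex function; this form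
   avoids infima of real functions. *)
Lemma hahn_banach n (E : 'rV[R]_n -> R -> Prop) :
  (forall x y r s t, E x r -> E y s -> 0 <= t -> t <= 1 ->
     E ((1 - t) *: x + t *: y) ((1 - t) * r + t * s)) ->
  (forall x, exists r, E x r) ->
  (forall r, E 0 r -> 0 <= r) ->
  exists z, forall x r, E x r -> dotp z x <= r.
Proof.
elim: n E => [|n IH] E cE dE pE.
  exists 0 => x r; rewrite (_ : x = 0); last by apply/rowP => -[].
  by rewrite dotp0l; exact: pE.
pose em (a : R) (p : 'rV[R]_n) : 'rV[R]_(1 + n) := row_mx a%:M p.
have emE (x : 'rV[R]_(1 + n)) : x = em (x 0 0) (rsubmx x).
  rewrite -[LHS]hsubmxK /em; congr row_mx; rewrite [LHS]mx11_scalar; congr _%:M.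
  by rewrite mxE; congr (x _ _); apply/val_inj.
have emD a b p q t : (1 - t) *: em a p + t *: em b q =
    em ((1 - t) * a + t * b) ((1 - t) *: p + t *: q).
  rewrite /em !scale_row_mx add_row_mx; congr row_mx.
  by apply/matrixP => i j; rewrite !ord1 !mxE eqxx !mulr1n.
have em_dot a b p q : dotp (em a p) (em b q) = a * b + dotp p q.
  rewrite {1}/dotp big_split_ord /= big_ord1 /em.
  rewrite !row_mxEl !mxE !mulr1n; congr (_ + _).
  by apply: eq_bigr => i _; rewrite !row_mxEr.
(* The induction hypothesis gives the functional on the hyperplane of first coordinate 0; only the
   coefficient of the first coordinate is left to choose. *)
have [|p|r|z' z'P] := IH (fun p r => E (em 0 p) r).
- move=> x y r s t Ex Ey t0 t1; have := cE _ _ _ _ _ Ex Ey t0 t1.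
  by rewrite emD !mulr0 addr0.
- exact: dE.
- move=> E0; apply: pE; have -> // : 0 = em 0 0.
  by rewrite /em raddf0 row_mx0.
(* [L] collects the lower bounds that points with negative first coordinate put on this coefficient.
   Points with positive first coordinate give upper bounds of [L], so [sup L] satisfies both
   kinds. *)
pose L := [set a | exists t p r, [/\ 0 < t, E (em (- t) p) r &
  a = (dotp z' p - r) / t]].
have L0 : L !=set0.
  have [r Er] := dE (em (- 1) 0).
  by exists ((dotp z' 0 - r) / 1), 1, 0, r.
have ubL t p r : 0 < t -> E (em t p) r -> ubound L ((r - dotp z' p) / t).
  move=> t0 Er _ [u [q [s [u0 Es ->]]]].
  have tun : t + u != 0 by apply: lt0r_neq0; exact: addr_gt0.
  (* With these weights the first coordinates [- u] and [t] cancel, and the combination lies in the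
     hyperplane. *)
  have w0 : 0 <= u / (t + u) by rewrite divr_ge0 ?addr_ge0 // ltW.
  have w1 : u / (t + u) <= 1.
    by rewrite ler_pdivrMr ?addr_gt0 // mul1r lerDr ltW.
  have := cE _ _ _ _ (u / (t + u)) Es Er w0 w1; rewrite emD.
  have -> : (1 - u / (t + u)) * - u + u / (t + u) * t = 0 by field.
  move=> /z'P; rewrite dotpDr !dotpZr.
  have -> : 1 - u / (t + u) = t / (t + u) by field.
  rewrite -(ler_pM2l (addr_gt0 t0 u0)) => le1.
  rewrite ler_pdivrMr // mulrAC ler_pdivlMr //.
  have e1 (v w : R) : (t + u) * (t / (t + u) * v + u / (t + u) * w) =
     t * v + u * w by field.
  by move: le1; rewrite !e1; lra.
have supL : has_sup L.
  by split=> //; have [r Er] := dE (em 1 0); exists ((r - dotp z' 0) / 1); exact: ubL.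
pose a := sup L.
exists (em a z') => x r; rewrite (emE (x : 'rV_(1 + n))) em_dot.
move: (x 0 0) (rsubmx (x : 'rV_(1 + n))) => t p Er.
have [t0|t0|t0] := ltrgt0P t.
- have : a <= (r - dotp z' p) / t by apply: ge_sup => //; exact: ubL.
  by rewrite ler_pdivlMr // mulrC; lra.
- have : (dotp z' p - r) / (- t) <= a.
    apply: ub_le_sup; first by case: supL.
    by exists (- t), p, r; rewrite opprK oppr_gt0.
  by rewrite ler_pdivrMr ?oppr_gt0 //; lra.
- by rewrite t0 in Er *; rewrite mulr0 add0r; exact: z'P.
Qed.

(** Hahn-Banach for the epigraph of [k], translated so that its point over [y0] becomes the
    origin. *)
Lemma subgradient n (k : 'rV[R]_n -> R) (y0 : 'rV[R]_n) :
  (forall x y t, 0 <= t -> t <= 1 ->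
     k ((1 - t) *: x + t *: y) <= (1 - t) * k x + t * k y) ->
  exists z, forall y, k y0 + dotp z (y - y0) <= k y.
Proof.
move=> ck.
have [x y r s t Ex Ey t0 t1|x|r|z zP] :=
  @hahn_banach n (fun p r => k (y0 + p) - k y0 <= r).
- have -> : y0 + ((1 - t) *: x + t *: y) =
      (1 - t) *: (y0 + x) + t *: (y0 + y).
    by rewrite !scalerDr addrACA -scalerDl subrK scale1r.
  have /= := ck (y0 + x) (y0 + y) t t0 t1.
  have := ler_wpM2l t0 Ey.
  have t1' : 0 <= 1 - t by rewrite subr_ge0.
  have := ler_wpM2l t1' Ex.
  lra.
- by exists (k (y0 + x) - k y0).
- by rewrite addr0 subrr.
exists z => y; rewrite addrC -lerBrDr; apply: zP.
by rewrite [y0 + _]addrC subrK.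
Qed.

End hahn_banach.

(** * Compact convex sets: segments, cubes and pieces of hyperplanes *)

Section compact_convex_sets.
Context {R : realType} {c : nat}.
Implicit Types x y z o p n : 'rV[R]_c.

Lemma rV_hausdorff : hausdorff_space 'rV[R]_c.
Proof. exact: (@norm_hausdorff R 'rV[R]_c). Qed.

Lemma compact_coord_bounded (K : set 'rV[R]_c) : compact K ->
  exists2 B, 0 < B & forall x, K x -> forall i, `|x 0 i| <= B.
Proof.
move=> kK; have [M [_ MP]] := compact_bounded kK.
exists (`|M| + 1); first by rewrite ltr_wpDl.
move=> x Kx i; have := MP (`|M| + 1) _ x Kx.
rewrite (le_lt_trans (ler_norm M)) ?ltrDl // => /(_ isT); apply: le_trans.
have /mapP[j Hj ->] : `|x 0 i| \in [seq `|x k.1 k.2| | k : 'I_1 * 'I_c].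
  by apply/mapP; exists (0, i) => //=; rewrite mem_enum.
rewrite [leRHS]/Num.norm /= mx_normrE; apply/bigmax_geP.
by right => /=; exists j.
Qed.

Lemma dotp_continuous z : continuous (fun x : 'rV[R]_c => dotp z x).
Proof.
rewrite /dotp; elim: (index_enum 'I_c) => [|i s IH] x.
  under eq_fun do rewrite big_nil.
  exact: cst_continuous.
under eq_fun do rewrite big_cons.
apply: (@continuousD _ _ _ (fun x : 'rV[R]_c => z 0 i * x 0 i)); last exact: IH.
by apply: continuousM; [exact: cst_continuous|exact: coord_continuous].
Qed.

Definition seg x y : set 'rV[R]_c :=
  [set (1 - t) *: x + t *: y | t in `[0, 1]].

Lemma segP x y p : seg x y p <->
  exists t, [/\ 0 <= t, t <= 1 & p = (1 - t) *: x + t *: y].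
Proof.
split=> [[t /= + <-]|[t [t0 t1 ->]]].
  by rewrite in_itv /= => /andP[t0 t1]; exists t.
by exists t => //=; rewrite in_itv /= t0 t1.
Qed.

Lemma segl x y : seg x y x.
Proof. by apply/segP; exists 0; rewrite subr0 scale1r scale0r addr0. Qed.

Lemma segr x y : seg x y y.
Proof. by apply/segP; exists 1; rewrite subrr scale1r scale0r add0r. Qed.

Lemma cvx_seg x y : cvx (seg x y).
Proof.
move=> p q t /segP[a [a0 a1 ->]] /segP[b [b0 b1 ->]] t0 t1; apply/segP.
exists ((1 - t) * a + t * b); split; [nra|nra|].
rewrite !scalerDr !scalerA addrACA -!scalerDl; congr (_ *: _ + _ *: _); ring.
Qed.

Lemma seg_cc x y : compact_convex (seg x y).
Proof.
split; last by apply/convex_setE; exact: cvx_seg.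
apply: continuous_compact; last exact: segment_compact.
apply: continuous_subspaceT => t.
apply: cvgD; apply: cvgZr_tmp; last exact: cvg_id.
by apply: cvgB; [exact: cvg_cst|exact: cvg_id].
Qed.

Lemma conv_hull2 x y : conv_hull ([set x] `|` [set y]) = seg x y.
Proof.
apply/seteqP; split.
  apply: smallest_sub; first by apply/convex_setE; exact: cvx_seg.
  by move=> _ [] ->; [exact: segl|exact: segr].
move=> _ /segP[t [t0 t1 ->]] B [/convex_setE cB sB].
by apply: cB => //; apply: sB; [left|right].
Qed.

Lemma point_cc x : compact_convex [set x].
Proof.
split; first exact: compact_set1.
apply/convex_setE => _ _ t -> -> _ _ /=.
by rewrite -scalerDl subrK scale1r.
Qed.

Lemma empty_cc : compact_convex (@set0 'rV[R]_c).
Proof. by split; [exact: compact0|apply/convex_setE => ? ? ? []]. Qed.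

Lemma ccI C D : compact_convex C -> compact_convex D ->
  @compact_convex R c (C `&` D).
Proof.
move=> [kC /convex_setE cC] [kD /convex_setE cD]; split.
  apply: (@subclosed_compact _ _ C) => //.
  apply: closedI; [exact: (compact_closed rV_hausdorff kC)|].
  exact: (compact_closed rV_hausdorff kD).
by apply/convex_setE; exact: cvxI.
Qed.

Definition box o (M : R) : set 'rV[R]_c :=
  [set p | forall i, `|(p - o) 0 i| <= M].

(** A compact substitute for the hyperplane, to which maps on compact convex sets can be applied. *)
Definition slice o M n (b : R) : set 'rV[R]_c :=
  box o M `&` [set p | dotp n (p - o) = b].

Lemma cvx_hyperplane o n b : cvx [set p : 'rV[R]_c | dotp n (p - o) = b].
Proof.
move=> p q t /=; rewrite !dotpE => e1 e2 _ _.
have -> : dotp n p = b + dotp n o by rewrite -e1 subrK.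
have -> : dotp n q = b + dotp n o by rewrite -e2 subrK.
by ring.
Qed.

Lemma box_cc o M : compact_convex (box o M).
Proof.
split; last first.
  apply/convex_setE => p q t /= bp bq t0 t1 i.
  have := bp i; have := bq i; rewrite !mxE !ler_norml => /andP[? ?] /andP[? ?].
  by apply/andP; split; nra.
rewrite (_ : box o M =
    [set v : 'rV[R]_c | forall i, `[(o 0 i - M), (o 0 i + M)]%classic (v 0 i)]).
  by apply: (@rV_compact R c (fun i => _)) => i; exact: segment_compact.
apply/seteqP; split=> p bp i; have := bp i; rewrite /= in_itv /= !mxE ler_norml.
  by move=> /andP[? ?]; apply/andP; split; lra.
by move=> /andP[? ?]; apply/andP; split; lra.
Qed.

Lemma slice_cc o M n b : compact_convex (slice o M n b).
Proof.
split; last first.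
  apply/convex_setE; apply: cvxI; last exact: cvx_hyperplane.
  by apply/convex_setE; case: (box_cc o M).
have [kB _] := box_cc o M.
apply: (subclosed_compact _ kB); last by move=> p [].
apply: closedI; first exact: (compact_closed rV_hausdorff kB).
rewrite (_ : [set p | _] = (fun p => dotp n p) @^-1` [set b + dotp n o]).
  by apply: closed_comp; [move=> *; exact: dotp_continuous|exact: closed_eq].
by apply/seteqP; split=> p /=; rewrite !dotpE => ?; lra.
Qed.

End compact_convex_sets.

(** * Tangent cones and maps compatible with intersections *)

Section cap_morphisms.
Context {R : realType} {c : nat} {V : lmodType R}.

(** The missing weight [1 - \sum_i a i] goes to the base point [e]. *)
Lemma cvx_sum_base (A : set V) (I : finType) (P : pred I) (a : I -> R)
    (x : I -> V) e :
  cvx A -> A e -> (forall i, P i -> 0 <= a i) -> (forall i, P i -> A (x i)) ->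
  \sum_(i | P i) a i <= 1 -> A (e + \sum_(i | P i) a i *: (x i - e)).
Proof.
move=> cA Ae a0 Ax a1; set S := \sum_(i | _) a i in a1.
have S0 : 0 <= S by exact: sumr_ge0.
have -> : \sum_(i | P i) a i *: (x i - e) = \sum_(i | P i) a i *: x i - S *: e.
  under eq_bigr do rewrite scalerBr.
  by rewrite sumrB scaler_suml.
have [SE|Sn0] := eqVneq S 0.
  rewrite SE scale0r subr0 big1 ?addr0 // => i Pi.
  have /eqP := SE; rewrite psumr_eq0 // => /allP /(_ i).
  by rewrite mem_index_enum Pi /= => /(_ isT) /eqP ->; rewrite scale0r.
have -> : e + (\sum_(i | P i) a i *: x i - S *: e) =
    (1 - S) *: e + S *: \sum_(i | P i) (a i / S) *: x i.
  rewrite scaler_sumr addrCA addrC scalerBl scale1r; congr (_ + _).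
  by apply: eq_bigr => i _; rewrite scalerA mulrC divfK.
apply: (cA) => //; apply: cvx_sum => //.
  by move=> i Pi; rewrite divr_ge0 // a0.
by rewrite -mulr_suml divff.
Qed.

(** The cone of feasible directions, without closure: for convex [A] containing [e], each of its
    directions has an initial segment inside [A]. *)
Definition tangent_cone (A : set V) e : set V :=
  [set v | exists2 t, 0 < t & A (e + t *: v)].

Lemma tangent_coneP (A : set V) e v : cvx A -> A e -> tangent_cone A e v ->
  exists2 t, 0 < t & forall s, 0 <= s -> s <= t -> A (e + s *: v).
Proof.
move=> cA Ae [t t0 Av]; exists t => // s s0 st.
have -> : e + s *: v = (1 - s / t) *: e + (s / t) *: (e + t *: v).
  rewrite scalerDr scalerA divfK ?gt_eqF // addrA; congr (_ + _).
  by rewrite scalerBl scale1r subrK.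
apply: cA => //; first by rewrite divr_ge0 // ltW.
by rewrite ler_pdivrMr // mul1r.
Qed.

Lemma tangent_cone0 (A : set V) e : A e -> tangent_cone A e 0.
Proof. by exists 1 => //; rewrite scaler0 addr0. Qed.

Lemma tangent_coneZ (A : set V) e v a :
  cvx A -> A e -> 0 <= a -> tangent_cone A e v ->
  tangent_cone A e (a *: v).
Proof.
move=> cA Ae; rewrite le_eqVlt => /predU1P[<- _|a0 [t t0 Av]].
  by rewrite scale0r; exact: tangent_cone0.
exists (t / a); first exact: divr_gt0.
by rewrite scalerA divfK // gt_eqF.
Qed.

Lemma tangent_coneD (A : set V) e u v :
  cvx A -> A e -> tangent_cone A e u -> tangent_cone A e v ->
  tangent_cone A e (u + v).
Proof.
move=> cA Ae /(tangent_coneP cA Ae)[t t0 tu] /(tangent_coneP cA Ae)[s s0 sv].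
have m0 : 0 < Num.min t s by rewrite lt_min t0 s0.
exists (Num.min t s / 2); first exact: divr_gt0.
have := cA _ _ 2^-1 (tu _ (ltW m0) _) (sv _ (ltW m0) _).
rewrite ge_min lexx ge_min lexx orbT => /(_ isT isT).
have h0 : 0 <= 2^-1 :> R by lra.
have h1 : 2^-1 <= 1 :> R by lra.
move=> /(_ h0 h1); congr A.
rewrite !scalerDr addrACA -scalerDl subrK scale1r !scalerA.
by congr (_ + (_ *: _ + _ *: _)); field.
Qed.

Lemma tangent_cone_sum (A : set V) e (I : finType) (P : pred I) (v : I -> V) :
  cvx A -> A e -> (forall i, P i -> tangent_cone A e (v i)) ->
  tangent_cone A e (\sum_(i | P i) v i).
Proof.
move=> cA Ae tv; elim/big_ind: _ => //; first exact: tangent_cone0.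
by move=> *; exact: tangent_coneD.
Qed.

Lemma tangent_coneS (A B : set V) e :
  A `<=` B -> tangent_cone A e `<=` tangent_cone B e.
Proof. by move=> AB v [t t0 Av]; exists t => //; exact: AB. Qed.

Lemma tangent_coneI (A B : set V) e v : cvx A -> cvx B -> A e -> B e ->
  tangent_cone A e v -> tangent_cone B e v -> tangent_cone (A `&` B) e v.
Proof.
move=> cA cB Ae Be /(tangent_coneP cA Ae)[t t0 tu] /(tangent_coneP cB Be)[s s0 sv].
have m0 : 0 < Num.min t s by rewrite lt_min t0 s0.
exists (Num.min t s) => //; split.
  by apply: tu; [exact: ltW|rewrite ge_min lexx].
by apply: sv; [exact: ltW|rewrite ge_min lexx orbT].
Qed.

(** The common abstraction of the zero level sets of the conjugates and of slices of their
    epigraphs. Monotonicity provides the inclusion opposite to the last clause. *)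
Definition cap_morphism (Zf : set 'rV[R]_c -> set V) :=
  [/\ forall C, compact_convex C -> cvx (Zf C),
      forall C D, compact_convex C -> compact_convex D -> C `<=` D ->
        Zf C `<=` Zf D &
      forall C D, compact_convex C -> compact_convex D ->
        Zf C `&` Zf D `<=` Zf (C `&` D)].

End cap_morphisms.

(** * Affine independence by Radon's argument *)

Section independence.
Context {R : realType} {c m : nat}.
Variable (k : nat).
Variables (Zf : set 'rV[R]_c -> set 'rV[R]_k).
Hypotheses (mZ : cap_morphism Zf) (Z0 : forall x, ~ Zf set0 x).

(* A linear dependency of the [z_k - e] yields, as in Radon's theorem, a point
   lying in the images of two disjoint slices of a box. *)
Lemma independence (D : 'M_(m, c)) (z : 'I_m -> 'rV[R]_k) o e :
  row_free D -> (forall i, Zf [set o + row i D] (z i)) -> Zf [set o] e ->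
  forall a : 'I_m -> R, \sum_i a i *: (z i - e) = 0 -> forall i, a i = 0.
Proof.
move=> /row_freeP[B DB] Zz Ze.
have [cZ sZ IZ] := mZ.
(* It suffices to exclude positive coefficients when the total is nonnegative: this is applied to
   [a] or to [- a], whichever has nonnegative total. *)
have key (a : 'I_m -> R) : \sum_i a i *: (z i - e) = 0 ->
    0 <= \sum_i a i -> forall i, a i <= 0.
  move=> a0 sa0 i0; rewrite leNgt; apply/negP => ai0.
  pose A := \sum_(i | 0 < a i) a i.
  have A0 : 0 < A.
    rewrite /A (bigD1 i0) //=; apply: ltr_pwDl => //.
    by apply: sumr_ge0 => i /andP[/ltW].
  (* The right inverse [B] of [D] yields a functional equal to 1 on the rows with positive
     coefficient and to 0 on the others; its two level sets are disjoint. *)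
  pose n : 'rV[R]_c := (B *m (\col_i (0 < a i)%R%:R))^T.
  have nD i : dotp n (row i D) = (0 < a i)%R%:R.
    have -> : dotp n (row i D) = (D *m (B *m (\col_i (0 < a i)%R%:R))) i 0.
      by rewrite dotpC [RHS]mxE; apply: eq_bigr => j _; rewrite !mxE.
    by rewrite mulmxA DB mul1mx mxE.
  pose M := \sum_i \sum_j `|D i j|.
  have oD i : slice o M n (0 < a i)%R%:R (o + row i D).
    split; last by rewrite /= addrAC subrr add0r nD.
    move=> j; rewrite addrAC subrr add0r mxE /M (bigD1 i) //= (bigD1 j) //=.
    by rewrite -addrA lerDl addr_ge0 // ?sumr_ge0 // => ? _; rewrite sumr_ge0.
  have oo : slice o M n 0 o.
    split; last by rewrite /= subrr dotp0r.
    by move=> j; rewrite subrr mxE normr0; do 2!apply: sumr_ge0 => ? _.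
  have Zs i : Zf (slice o M n (0 < a i)%R%:R) (z i).
    by apply: sZ (Zz i); [exact: point_cc|exact: slice_cc|move=> _ ->].
  have Zs0 : Zf (slice o M n 0) e.
    by apply: sZ Ze; [exact: point_cc|exact: slice_cc|move=> _ ->].
  (* The Radon point, written in two ways: by the positive coefficients at level 1, and by the
     others at level 0. In the second form the weights sum to at most 1 because the total is
     nonnegative, and [e] takes the rest. *)
  have p1 : Zf (slice o M n 1) (\sum_(i | 0 < a i) (a i / A) *: z i).
    apply: cvx_sum; first exact/cZ/slice_cc.
    - by move=> i ai; rewrite divr_ge0 // ltW.
    - by move=> i ai; have := Zs i; rewrite ai.
    - by rewrite -mulr_suml divff // gt_eqF.
  have p2 : Zf (slice o M n 0)
      (e + \sum_(i | ~~ (0 < a i)) (- a i / A) *: (z i - e)).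
    apply: cvx_sum_base => //; first exact/cZ/slice_cc.
    - by move=> i; rewrite -leNgt => ai; rewrite divr_ge0 ?oppr_ge0 // ltW.
    - by move=> i /negPf ai; have := Zs i; rewrite ai.
    - rewrite -mulr_suml ler_pdivrMr // mul1r sumrN.
      by rewrite -subr_ge0 opprK; move: sa0; rewrite (bigID (fun i => 0 < a i)).
  apply: (@Z0 (\sum_(i | 0 < a i) (a i / A) *: z i)).
  rewrite (_ : set0 = slice o M n 1 `&` slice o M n 0).
    apply: IZ; try exact: slice_cc; split=> //.
    rewrite (_ : \sum_(i | _) _ =
      e + \sum_(i | ~~ (0 < a i)) (- a i / A) *: (z i - e)) //.
    apply/eqP; rewrite addrC -subr_eq; apply/eqP.
    have -> : \sum_(i | 0 < a i) (a i / A) *: z i - e =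
        \sum_(i | 0 < a i) (a i / A) *: (z i - e).
      under [RHS]eq_bigr do rewrite scalerBr.
      by rewrite sumrB -scaler_suml -mulr_suml divff ?gt_eqF // scale1r.
    apply/eqP; rewrite -subr_eq0 -sumrN.
    have E : \sum_i (a i / A) *: (z i - e) = 0.
      under eq_bigr do rewrite mulrC -scalerA.
      by rewrite -scaler_sumr a0 scaler0.
    rewrite (bigID (fun i => 0 < a i)) /= in E.
    rewrite -[X in _ == X]E; apply/eqP; congr (_ + _).
    by apply: eq_bigr => i _; rewrite -scaleNr mulNr opprK.
  apply/esym/seteqP; split=> // p [[_ /= e1] [_ /= e0]].
  by move: e1; rewrite e0 => /eqP; rewrite eq_sym oner_eq0.
move=> a a0.
have aux (b : 'I_m -> R) : (forall i, 0 <= b i) -> \sum_i b i <= 0 ->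
    forall i, b i = 0.
  move=> b0 sb i; apply: (@psumr_eq0P R 'I_m xpredT b) => //.
  by apply/eqP; rewrite eq_le sb sumr_ge0.
have [sa|/ltW sa] := leP 0 (\sum_i a i).
  move=> i; apply/eqP; rewrite -oppr_eq0; apply/eqP.
  apply: (aux (fun i => - a i)); last by rewrite sumrN oppr_le0.
  by move=> j; rewrite oppr_ge0; exact: key.
apply: aux => // i; rewrite -oppr_le0.
apply: (key (fun i => - a i)); last by rewrite sumrN oppr_ge0.
by under eq_bigr do rewrite scaleNr; rewrite sumrN a0 oppr0.
Qed.

End independence.

(** * The image of a point is a single point *)

Section singletons.
Context {R : realType} {c : nat}.
Hypothesis c2 : (2 <= c)%N.
Variable Zf : set 'rV[R]_c -> set 'rV[R]_c.
Hypotheses (mZ : cap_morphism Zf) (Z0 : forall x, ~ Zf set0 x).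
Hypothesis Zne : forall x, exists z, Zf [set x] z.
Hypothesis Zbetween : forall o d e, Zf [set o] e ->
  exists r, Zf [set o + d] (e + r) /\ exists2 a, 0 < a & Zf [set o - d] (e - a *: r).
Hypothesis Zclosed : forall o e z,
  (forall s, 0 <= s -> s < 1 -> Zf [set o] ((1 - s) *: e + s *: z)) -> Zf [set o] z.

Lemma disjoint_points x y z : Zf [set x] z -> Zf [set y] z -> x = y.
Proof.
have [_ _ IZ] := mZ => Zx Zy; apply: contrapT => xy.
apply: (@Z0 z); rewrite (_ : set0 = [set x] `&` [set y]).
  by apply: IZ; [exact: point_cc|exact: point_cc|split].
by apply/esym/seteqP; split=> // p [-> yp]; case: xy.
Qed.

(** One nonzero tangent direction [q - e] is propagated to all directions. Over a segment through
    [o] in direction [d] the tangent cone at [e] contains a line, and such a segment meets a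
    hyperplane transverse to [d] in [o] alone; a direction tangent to both images is therefore
    tangent to [Zf [set o]]. *)
Lemma tangent_cone_full o e q : Zf [set o] e -> Zf [set o] q -> q <> e ->
  forall v, tangent_cone (Zf [set o]) e v.
Proof.
move=> Ze Zq qe.
have [cZ sZ IZ] := mZ.
have cvx0 : cvx (Zf [set o]) by exact/cZ/point_cc.
pose dir (d r : 'rV[R]_c) := Zf [set o + d] (e + r) /\
  exists2 a, 0 < a & Zf [set o - d] (e - a *: r).
have /choice[r rP] : forall i, exists x, dir (delta_mx 0 i) x.
  by move=> i; exact: Zbetween.
have [rs rsP] : {rs | dir (const_mx 1) rs} by apply/cid/Zbetween.
pose S (d : 'rV[R]_c) := seg (o - d) (o + d).
have So d : S d o.
  apply/segP; exists 2^-1; split; [lra|lra|].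
  by apply/rowP => i; rewrite !mxE; lra.
have SZe d : Zf (S d) e.
  by apply: sZ Ze; [exact: point_cc|exact: seg_cc|move=> _ ->].
have tS (d x : 'rV[R]_c) (a : R) : dir d x -> tangent_cone (Zf (S d)) e (a *: x).
  have cS : cvx (Zf (S d)) by exact/cZ/seg_cc.
  move=> [Zp [b b0 Zm]]; have [a0|/ltW a0] := leP 0 a.
    apply: tangent_coneZ => //; exists 1 => //; rewrite scale1r.
    by apply: sZ Zp; [exact: point_cc|exact: seg_cc|move=> _ ->; exact: segr].
  rewrite -[a]opprK scaleNr -scalerN; apply: tangent_coneZ => //.
    by rewrite oppr_ge0.
  exists b => //; rewrite scalerN.
  by apply: sZ Zm; [exact: point_cc|exact: seg_cc|move=> _ ->; exact: segl].
have Ss (d n : 'rV[R]_c) :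
    (forall i, `|d 0 i| <= 1) -> dotp n d = 0 -> S d `<=` slice o 1 n 0.
  move=> d1 nd p /segP[t [t0 t1 ->]].
  have -> : (1 - t) *: (o - d) + t *: (o + d) = o + (2 * t - 1) *: d.
    by apply/rowP => i; rewrite !mxE; ring.
  split; last by rewrite /= addrAC subrr add0r dotpZr nd mulr0.
  move=> i; rewrite addrAC subrr add0r mxE normrM.
  rewrite -[leRHS]mulr1; apply: ler_pM => //.
  by rewrite ler_norml; apply/andP; split; lra.
have sliceo (n : 'rV[R]_c) : slice o 1 n 0 o.
  split=> [i|]; last by rewrite /= subrr dotp0r.
  by rewrite subrr mxE normr0.
have sliceZe (n : 'rV[R]_c) : Zf (slice o 1 n 0) e.
  by apply: sZ Ze; [exact: point_cc|exact: slice_cc|move=> _ ->].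
have cslice (n : 'rV[R]_c) : cvx (Zf (slice o 1 n 0)) by exact/cZ/slice_cc.
pose T := tangent_cone (Zf [set o]) e.
have claim (d x : 'rV[R]_c) (a : R) (n : 'rV[R]_c) : dir d x -> dotp n d != 0 ->
    tangent_cone (Zf (slice o 1 n 0)) e (a *: x) -> T (a *: x).
  move=> dx nd ts.
  have sub : S d `&` slice o 1 n 0 `<=` [set o].
    move=> p [/segP[t [t0 t1 pE]] [_ /= np]].
    have E : p = o + (2 * t - 1) *: d.
      by rewrite pE; apply/rowP => i; rewrite !mxE; ring.
    move: np; rewrite E addrAC subrr add0r dotpZr => /eqP.
    by rewrite mulf_eq0 (negPf nd) orbF => /eqP ->; rewrite scale0r addr0.
  have : tangent_cone (Zf (S d) `&` Zf (slice o 1 n 0)) e (a *: x).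
    apply: tangent_coneI => //; first exact/cZ/seg_cc.
    exact: tS.
  apply: tangent_coneS => p Zp; have := IZ _ _ (seg_cc _ _) (slice_cc _ _ _ _) _ Zp.
  apply: (sZ _ _ _ _ sub); last exact: point_cc.
  by apply: ccI; [exact: seg_cc|exact: slice_cc].
have inslice (d x : 'rV[R]_c) (a : R) (n : 'rV[R]_c) :
    dir d x -> (forall i, `|d 0 i| <= 1) -> dotp n d = 0 ->
    tangent_cone (Zf (slice o 1 n 0)) e (a *: x).
  move=> dx d1 nd; have := tS d x a dx; apply: tangent_coneS.
  by apply: sZ => //; [exact: seg_cc|exact: slice_cc|exact: Ss].
have Tslice (n v : 'rV[R]_c) : T v -> tangent_cone (Zf (slice o 1 n 0)) e v.
  by apply: tangent_coneS; apply: sZ; [exact: point_cc|exact: slice_cc|move=> _ ->].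
have delta1 (j i : 'I_c) : `|(delta_mx 0 j : 'rV[R]_c) 0 i| <= 1.
  by rewrite mxE eqxx /=; case: (i == j); rewrite ?normr0 ?normr1.
have ones1 i : `|(const_mx 1 : 'rV[R]_c) 0 i| <= 1 by rewrite mxE normr1.
have ddd (i j : 'I_c) : dotp (delta_mx 0 i) (delta_mx 0 j) = (i == j)%:R :> R.
  by rewrite dotp_delta mxE eqxx /= eq_sym.
have dd1 (i : 'I_c) : dotp (delta_mx 0 i) (const_mx 1) = 1 :> R.
  by rewrite dotpC dotp_delta mxE.
pose Rm : 'M[R]_c := \matrix_i r i.
have RmE (v : 'rV[R]_c) : v *m Rm = \sum_i v 0 i *: r i.
  by rewrite mulmx_sum_row; apply: eq_bigr => i _; rewrite rowK.
have Rmu : Rm \in unitmx.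
  rewrite -row_free_unit; apply: inj_row_free => v vR.
  apply/rowP => i; rewrite mxE; move: i.
  apply: (@independence R c c c Zf mZ Z0 1%:M (fun i => e + r i) o e) => //.
  - by apply/row_freeP; exists 1%:M; rewrite mulmx1.
  - by move=> i; rewrite row1; case: (rP i).
  - by rewrite -[RHS]vR RmE; apply: eq_bigr => i _; rewrite addrAC subrr add0r.
have coord (v : 'rV[R]_c) : v = \sum_i (v *m invmx Rm) 0 i *: r i.
  by rewrite -RmE mulmxKV.
pose a := rs *m invmx Rm.
(* With the all-ones vector in place of the [k]-th basis vector the directions stay independent, so
   [rs] is not in the span of the other [r i]. *)
have an0 k : a 0 k != 0.
  apply/eqP => ak0.
  pose D : 'M[R]_c := \matrix_i (if i == k then const_mx 1 else delta_mx 0 i).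
  have rfD : row_free D.
    apply: inj_row_free => v vD.
    have vE : \sum_i v 0 i *:
        (if i == k then const_mx 1 else delta_mx 0 i) = 0 :> 'rV[R]_c.
      by rewrite -[RHS]vD mulmx_sum_row; apply: eq_bigr => i _; rewrite rowK.
    have vk : v 0 k = 0.
      have := congr1 (fun w : 'rV[R]_c => w 0 k) vE; rewrite summxE (bigD1 k) //= big1.
        by rewrite eqxx !mxE mulr1 addr0.
      by move=> i /negPf ik; rewrite ik !mxE eqxx /= eq_sym ik mulr0.
    apply/rowP => j; rewrite mxE; have [->//|jk] := eqVneq j k.
    have := congr1 (fun w : 'rV[R]_c => w 0 j) vE; rewrite summxE (bigD1 j) //= big1.
      by rewrite (negPf jk) !mxE !eqxx mulr1 addr0.
    move=> i /negPf ij; have [->|ik] := eqVneq i k; first by rewrite vk scale0r mxE.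
    by rewrite !mxE eqxx /= eq_sym ij mulr0.
  pose f i := if i == k then 1 else - a 0 i.
  suff /(_ k) : forall i, f i = 0 by rewrite /f eqxx => /eqP; rewrite oner_eq0.
  apply: (@independence R c c c Zf mZ Z0 D
    (fun i => e + if i == k then rs else r i) o e) => //.
    by move=> i; rewrite rowK; case: eqP => _; [case: rsP|case: (rP i)].
  rewrite (bigD1 k) //= /f eqxx scale1r [e + _]addrC addrK.
  rewrite [X in X + _](coord rs) -/a (bigD1 k) //= ak0 scale0r add0r -big_split /=.
  by apply: big1 => i /negPf ->; rewrite addrAC subrr add0r -scalerDl subrr scale0r.
have rsE : rs = \sum_i a 0 i *: r i by exact: coord.
(* The other [r i] come from coordinate directions inside the hyperplane of vanishing [k]-th
   coordinate, so their multiples may be subtracted from [u]. *)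
have stepA (u : 'rV[R]_c) k : T u -> T ((u *m invmx Rm) 0 k *: r k).
  move=> Tu; set l := u *m invmx Rm.
  apply: (claim (delta_mx 0 k) _ _ (delta_mx 0 k)) => //.
    by rewrite ddd eqxx oner_neq0.
  have -> : l 0 k *: r k = u + \sum_(i | i != k) (- l 0 i) *: r i.
    rewrite [X in X + _](coord u) -/l (bigD1 k) //= -addrA -big_split /=.
    by rewrite big1 ?addr0 // => i _; rewrite -scalerDl subrr scale0r.
  apply: tangent_coneD => //; first exact: Tslice.
  apply: tangent_cone_sum => // i ik; apply: (inslice (delta_mx 0 i)) => //.
  by rewrite ddd eq_sym (negPf ik).
have stepB (mu : R) k : T (mu *: r k) -> T ((mu / a 0 k) *: rs).
  move=> Tr.
  apply: (claim (const_mx 1) _ _ (delta_mx 0 k)) => //; first by rewrite dd1 oner_neq0.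
  have -> : (mu / a 0 k) *: rs =
      mu *: r k + \sum_(i | i != k) (mu / a 0 k * a 0 i) *: r i.
    rewrite {1}rsE scaler_sumr (bigD1 k) //= scalerA divfK //; congr (_ + _).
    by apply: eq_bigr => i _; rewrite scalerA.
  apply: tangent_coneD => //; first exact: Tslice.
  apply: tangent_cone_sum => // i ik; apply: (inslice (delta_mx 0 i)) => //.
  by rewrite ddd eq_sym (negPf ik).
(* The hyperplane where coordinates [j] and [k] agree contains the all-ones direction. Subtracting a
   multiple of [rs] removes [r k] and leaves a multiple of [r j] whose sign is opposite to the one
   obtained from [stepB] and [stepA]. *)
have stepC (mu : R) k j : j != k -> T (mu *: r k) -> T (- (mu / a 0 k * a 0 j) *: r j).
  move=> jk Tr.
  have ndE (d : 'rV[R]_c) : dotp (delta_mx 0 j - delta_mx 0 k) d = d 0 j - d 0 k :> R.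
    by rewrite dotpDl dotpNl !(dotpC (delta_mx _ _)) !dotp_delta.
  apply: (claim (delta_mx 0 j) _ _ (delta_mx 0 j - delta_mx 0 k)) => //.
    by rewrite ndE !mxE !eqxx /= [k == j]eq_sym (negPf jk) subr0 oner_neq0.
  have -> : - (mu / a 0 k * a 0 j) *: r j = mu *: r k + (- (mu / a 0 k)) *: rs +
      \sum_(i | (i != k) && (i != j)) (mu / a 0 k * a 0 i) *: r i.
    rewrite {1}rsE scaler_sumr (bigD1 k) //= (bigD1 j) //= !scalerA !mulNr divfK //.
    rewrite !scaleNr addrA addrA subrr add0r -addrA -big_split /= big1 ?addr0 //.
    by move=> i _; rewrite scalerA mulNr scaleNr addNr.
  apply: tangent_coneD => //.
    apply: tangent_coneD => //; first exact: Tslice.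
    apply: (inslice (const_mx 1)) => //.
    by rewrite ndE !mxE subrr.
  apply: tangent_cone_sum => // i /andP[ik ij]; apply: (inslice (delta_mx 0 i)) => //.
  by rewrite ndE !mxE /= [k == i]eq_sym [j == i]eq_sym (negPf ik) (negPf ij) subrr.
have rsinv k : (rs *m invmx Rm) 0 k = a 0 k by [].
have both (mu : R) k j :
    mu != 0 -> j != k -> T (mu *: r k) -> forall b : R, T (b *: r j).
  move=> mu0 jk Tr b.
  have m1 := stepC _ _ _ jk Tr.
  have := stepA _ j (stepB _ _ Tr); rewrite -scalemxAl mxE rsinv => m2.
  have w0 : mu / a 0 k * a 0 j != 0 by rewrite !mulf_neq0 ?invr_eq0.
  set w := mu / a 0 k * a 0 j in m1 m2 w0.
  have pos (x : R) : x != 0 -> T (x *: r j) -> 0 <= b / x -> T (b *: r j).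
    move=> x0 Tx bx; rewrite -(divfK x0 b) -scalerA; exact: tangent_coneZ.
  have [bw|bw] := leP 0 (b / w); first exact: pos m2 bw.
  by apply: pos m1 _; rewrite ?oppr_eq0 // invrN mulrN oppr_ge0 ltW.
have [k lk] : exists k, ((q - e) *m invmx Rm) 0 k != 0.
  apply: rV_neq0 => l0; apply: qe; apply/eqP; rewrite -subr_eq0.
  by rewrite -(mulmxKV Rmu (q - e)) l0 mul0mx.
have Tq : T (q - e) by exists 1 => //; rewrite scale1r addrC subrK.
have Tk := stepA _ k Tq.
have [j jk] := ord_neq k c2.
have Tj := both _ _ _ lk jk Tk.
have Tall i (b : R) : T (b *: r i).
  have [->//|ij] := eqVneq i j.
  exact: (both 1 j i (oner_neq0 _) ij (Tj 1)).
by move=> v; rewrite (coord v); apply: tangent_cone_sum => // i _; exact: Tall.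
Qed.

(** Follow the segment from [e] towards a point [z] over another singleton as long as it stays in
    [Zf [set o]]. If the set had two points, the tangent cone at the last point [e1] would be
    everything, and the segment could be continued. *)
Lemma singleton o e q : Zf [set o] e -> Zf [set o] q -> q = e.
Proof.
move=> Ze Zq; apply: contrapT => qe.
have c1 : (0 < c)%N by exact: leq_trans c2.
have cvx0 : cvx (Zf [set o]) by have [cZ _ _] := mZ; exact/cZ/point_cc.
have [z Zz] := Zne (o + delta_mx 0 (Ordinal c1)).
have zo : ~ Zf [set o] z.
  move=> /(disjoint_points Zz) /eqP; rewrite addrC -subr_eq0 addrK => /eqP.
  move=> /(congr1 (fun w : 'rV[R]_c => w 0 (Ordinal c1))); rewrite !mxE !eqxx /=.
  by move=> /eqP; rewrite oner_eq0.
pose P s := 0 <= s /\ Zf [set o] ((1 - s) *: e + s *: z).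
have P0 : P 0 by split=> //; rewrite subr0 scale1r scale0r addr0.
have P1 s : P s -> s <= 1.
  move=> [s0 Zs]; rewrite leNgt; apply/negP => s1; apply: zo.
  have sn : s != 0 by rewrite gt_eqF // (lt_trans ltr01).
  have -> : z = (1 - s^-1) *: e + s^-1 *: ((1 - s) *: e + s *: z).
    rewrite scalerDr !scalerA mulVf // scale1r addrA -scalerDl.
    have -> : 1 - s^-1 + s^-1 * (1 - s) = 0 by field.
    by rewrite scale0r add0r.
  by apply: cvx0 => //; rewrite ?invr_ge0 // invf_le1 ?ltW // (lt_trans ltr01).
pose m := sup P.
have hP : has_sup P by split; [exists 0|exists 1 => s /P1].
have m0 : 0 <= m by apply: ub_le_sup; [case: hP|].
pose e1 := (1 - m) *: e + m *: z.
have below s : 0 <= s -> s < m -> Zf [set o] ((1 - s) *: e + s *: z).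
  move=> s0 sm; have [|u [u0 Zu] su] := @sup_adherent _ P (m - s) _ hP.
    by rewrite subr_gt0.
  rewrite -/m opprB addrCA subrr addr0 in su.
  have un : u != 0 by rewrite gt_eqF // (le_lt_trans s0).
  have -> : (1 - s) *: e + s *: z =
      (1 - s / u) *: e + (s / u) *: ((1 - u) *: e + u *: z).
    rewrite scalerDr !scalerA divfK // addrA -scalerDl; congr (_ *: _ + _).
    by field.
  apply: cvx0 => //; first by rewrite divr_ge0.
  by rewrite ler_pdivrMr ?(le_lt_trans s0) // mul1r ltW.
have e1s s : (1 - s) *: e + s *: e1 = (1 - s * m) *: e + (s * m) *: z.
  rewrite /e1 scalerDr !scalerA addrA -scalerDl; congr (_ *: _ + _).
  by ring.
have Ze1 : Zf [set o] e1.
  have [m00|mn0] := eqVneq m 0; first by rewrite /e1 m00 subr0 scale1r scale0r addr0.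
  have mp : 0 < m by rewrite lt_neqAle eq_sym mn0.
  apply: (@Zclosed o e) => s s0 s1; rewrite e1s; apply: below; first exact: mulr_ge0.
  by rewrite gtr_pMl.
(* [e1] may coincide with [e]; then [q] serves as the second point. *)
have [q1 Zq1 q1e] : exists2 q1, Zf [set o] q1 & q1 <> e1.
  have [ee|ee] := pselect (e = e1); last by exists e.
  by exists q => // qq; apply: qe; rewrite qq.
have m1 : m < 1.
  rewrite lt_neqAle; apply/andP; split; last by apply: ge_sup => [|s /P1//]; exists 0.
  apply/eqP => m1; apply: zo; move: Ze1.
  by rewrite /e1 m1 subrr scale0r add0r scale1r.
have [t t0] := tangent_cone_full Ze1 Zq1 q1e (z - e1).
have -> : e1 + t *: (z - e1) = (1 - (m + t * (1 - m))) *: e + (m + t * (1 - m)) *: z.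
  by apply/rowP => i; rewrite !mxE; ring.
have mt : 0 < t * (1 - m) by rewrite mulr_gt0 // subr_gt0.
move=> Zt; have : m + t * (1 - m) <= m.
  by apply: ub_le_sup; [case: hP|split=> //; rewrite addr_ge0 // ltW].
by rewrite gerDl leNgt mt.
Qed.

End singletons.

(** * Maps preserving betweenness and noncollinearity are affine *)

Lemma affine_seq_nondecr (R : realType) (g : nat -> R) :
  (forall n, 0 < g n) -> (forall n, g n.+2 - g n.+1 = g n.+1 - g n) ->
  g 0%N <= g 1%N.
Proof.
move=> g0 gd; rewrite leNgt; apply/negP => lt10.
have gE n : g n = g 0%N - n%:R * (g 0%N - g 1%N).
  have dE m : g m.+1 - g m = g 1%N - g 0%N by elim: m => // m <-.
  elim: n => [|n IH]; first by rewrite mul0r subr0.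
  have := dE n; rewrite IH -natr1; lra.
have d0 : 0 < g 0%N - g 1%N by rewrite subr_gt0.
(* By Archimedes, a progression with negative difference reaches a nonpositive term. *)
have := g0 (Num.bound (g 0%N / (g 0%N - g 1%N))).
rewrite gE subr_gt0 -ltr_pdivlMr // ltNge => /negP; apply.
by apply/ltW/archi_boundP; rewrite divr_ge0 // ltW.
Qed.

Section affine.
Context {R : realType} {c : nat}.
Hypothesis c2 : (2 <= c)%N.
Local Notation E := 'rV[R]_c.
Implicit Types x y a b P : E.

Definition noncollinear P a b := forall s t : R,
  s *: (a - P) + t *: (b - P) = 0 -> s = 0 /\ t = 0.

Lemma bary P a b (p q r p' q' r' : R) : noncollinear P a b ->
  p *: P + q *: a + r *: b = p' *: P + q' *: a + r' *: b ->
  p + q + r = p' + q' + r' -> [/\ p = p', q = q' & r = r'].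
Proof.
move=> h e1 e2; have [] := h (q - q') (r - r').
  have -> : (q - q') *: (a - P) + (r - r') *: (b - P) =
    (p *: P + q *: a + r *: b) - (p' *: P + q' *: a + r' *: b)
    - (p + q + r - (p' + q' + r')) *: P.
    by apply/rowP => i; rewrite !mxE; ring.
  by rewrite e1 e2 !subrr scale0r subr0.
move=> qq rr; split; lra.
Qed.

Definition mid x y : E := 2^-1 *: (x + y).

Variable phi : E -> E.
Hypothesis phi_between : forall x y t, 0 < t -> t < 1 ->
  exists s, [/\ 0 < s, s < 1 &
    phi ((1 - t) *: x + t *: y) = (1 - s) *: phi x + s *: phi y].
Hypothesis phi_nc : forall P a b,
  noncollinear P a b -> noncollinear (phi P) (phi a) (phi b).

(** [r] is the weight of the image of [xy.2] relative to that of [xy.1]. For a projective map it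
    would be a quotient of two values of an affine function; the lemmas below recover such a
    function and show that it is constant. *)
Let rho_ex : forall xy : E * E, exists r : R, 0 < r /\
  phi (mid xy.1 xy.2) = (1 + r)^-1 *: (phi xy.1 + r *: phi xy.2).
Proof.
move=> [x y] /=; have [||s [s0 s1 e]] := @phi_between x y 2^-1; [lra|lra|].
have s1n : 1 - s != 0 by rewrite subr_eq0 gt_eqF.
exists (s / (1 - s)); split; first by rewrite divr_gt0 // subr_gt0.
rewrite -[mid x y](_ : (1 - 2^-1) *: x + 2^-1 *: y = _).
  rewrite e scalerDr scalerA.
  have k : 1 + s / (1 - s) = (1 - s)^-1 by field.
  by rewrite k invrK; congr (_ + _ *: _); field.
by apply/rowP => i; rewrite !mxE; lra.
Qed.

Let rho x y := projT1 (cid (rho_ex (x, y))).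

Let rho_gt0 x y : 0 < rho x y.
Proof. by rewrite /rho; case: cid => r []. Qed.

Let rhoE x y : phi (mid x y) = (1 + rho x y)^-1 *: (phi x + rho x y *: phi y).
Proof. by rewrite /rho; case: cid => r [] /=. Qed.

(* The three medians of a triangle meet, as do the images of these. *)
Let rho_cocycle P a b : noncollinear P a b -> rho P a * rho a b = rho P b.
Proof.
move=> h; have h' := phi_nc h.
pose g : E := 3^-1 *: (P + a + b).
(* The centroid divides each median in the ratio 2 : 1. *)
have t0 : 0 < 2 / 3 :> R by lra.
have t1 : 2 / 3 < 1 :> R by lra.
have gE x y z : 3^-1 *: (x + y + z) = (1 - 2 / 3) *: x + (2 / 3) *: mid y z :> E.
  by apply/rowP => i; rewrite !mxE; field.
have [s [s0 s1 e1]] := phi_between P (mid a b) t0 t1.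
have [u [u0 u1 e2]] := phi_between b (mid P a) t0 t1.
have [v [v0 v1 e3]] := phi_between a (mid P b) t0 t1.
rewrite -gE -/g rhoE in e1; rewrite -gE (_ : b + P + a = P + a + b) in e2; last first.
  by rewrite -addrA addrC.
rewrite -gE (_ : a + P + b = P + a + b) in e3; last by rewrite [a + P]addrC.
rewrite -/g rhoE in e2; rewrite -/g rhoE in e3.
have pos := (rho_gt0 a b, rho_gt0 P a, rho_gt0 P b).
have n x y : 1 + rho x y != 0 by rewrite gt_eqF // addr_gt0.
set r1 := rho a b in e1 pos *; set r2 := rho P a in e2 pos *.
set r3 := rho P b in e3 pos *.
have n1 : 1 + r1 != 0 by exact: n.
have n2 : 1 + r2 != 0 by exact: n.
have n3 : 1 + r3 != 0 by exact: n.
have [||p12 q12 r12] := @bary _ _ _ (1 - s) (s / (1 + r1)) (s / (1 + r1) * r1)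
  (u / (1 + r2)) (u / (1 + r2) * r2) (1 - u) h'.
- transitivity (phi g); [rewrite e1|rewrite e2].
    by apply/rowP => i; rewrite !mxE; field.
  by apply/rowP => i; rewrite !mxE; field.
- by field; rewrite ?n1 ?n2 ?n3.
have [||p13 q13 r13] := @bary _ _ _ (1 - s) (s / (1 + r1)) (s / (1 + r1) * r1)
  (v / (1 + r3)) (1 - v) (v / (1 + r3) * r3) h'.
- transitivity (phi g); [rewrite e1|rewrite e3].
    by apply/rowP => i; rewrite !mxE; field.
  by apply/rowP => i; rewrite !mxE; field.
- by field; rewrite ?n1 ?n2 ?n3.
have s1n : 1 - s != 0 by rewrite subr_eq0 gt_eqF.
apply: (mulfI s1n).
by rewrite [in RHS]p13 -r13 q12 -p12 mulrA.
Qed.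

(** The points [mid (mid a b) (mid P a)] and [mid a (mid P b)] coincide. Comparing the barycentric
    coordinates of their images, and using [rho_cocycle], shows that the weights seen from [P] are
    averaged at midpoints. *)
Let step P a b : noncollinear P a b ->
  rho P (mid a b) / (rho P a + rho P b) = rho P (mid P a) / (1 + rho P a) /\
  rho P (mid P b) = (1 + rho P b) / 2.
Proof.
move=> h; have h' := phi_nc h.
have hm : noncollinear P (mid a b) (mid P a).
  move=> s t e.
  have [] := h (s / 2 + t / 2) (s / 2); last by move=> ? ?; lra.
  by rewrite -[RHS]e; apply/rowP => i; rewrite !mxE; field.
have ha : noncollinear P a (mid P b).
  move=> s t e; have [] := h s (t / 2); last by move=> ? ?; lra.
  by rewrite -[RHS]e; apply/rowP => i; rewrite !mxE; field.
have := rhoE (mid a b) (mid P a); have := rhoE a (mid P b).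
have -> : mid (mid a b) (mid P a) = mid a (mid P b).
  by apply/rowP => i; rewrite !mxE; field.
move=> -> ; rewrite !rhoE.
move: (rho_cocycle h) (rho_cocycle hm) (rho_cocycle ha).
move: (rho_gt0 P a) (rho_gt0 P b) (rho_gt0 P (mid a b))
  (rho_gt0 P (mid P a)) (rho_gt0 P (mid P b)).
move: (rho_gt0 a b) (rho_gt0 (mid a b) (mid P a)) (rho_gt0 a (mid P b)).
move: (rho P (mid a b)) (rho P (mid P a)) (rho P (mid P b)).
move: (rho a b) (rho (mid a b) (mid P a)) (rho a (mid P b)) (rho P a) (rho P b).
move=> rab rm ra wa wb wm wma wmb rab0 rm0 ra0 wa0 wb0 wm0 wma0 wmb0 c1 c2' c3 e.
have np (x : R) : 0 < x -> 1 + x != 0 by move=> x0; rewrite gt_eqF // addr_gt0.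
have n1 := np _ rab0; have n2 := np _ rm0; have n3 := np _ ra0.
have n4 := np _ wa0; have n5 := np _ wb0.
have [||pp qq rr] := @bary _ _ _
  (ra / (1 + ra) / (1 + wb)) (1 + ra)^-1 (ra / (1 + ra) * wb / (1 + wb))
  (rm / (1 + rm) / (1 + wa))
  ((1 + rm)^-1 / (1 + rab) + rm / (1 + rm) * wa / (1 + wa))
  ((1 + rm)^-1 * rab / (1 + rab)) h'.
- move: e; set X := (X in X = _ -> _); set Y := (Y in _ = Y -> _) => XY.
  transitivity X; first by rewrite /X; apply/rowP => i; rewrite !mxE; field;
    rewrite ?n1 ?n2 ?n3 ?n4 ?n5 ?n6.
  by rewrite XY /Y; apply/rowP => i; rewrite !mxE; field; rewrite ?n1 ?n2 ?n3 ?n4 ?n5 ?n6.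
- by field; rewrite ?n1 ?n2 ?n3 ?n4 ?n5 ?n6.
have n6 : rab != 0 by rewrite gt_eqF.
have hA : wa * rm * (1 + rab) = 1 + wa.
  have e1 : wb * (rm / (1 + rm) / (1 + wa)) = rab / ((1 + rm) * (1 + rab)).
    rewrite -pp; transitivity (ra / (1 + ra) * wb / (1 + wb)); first by ring.
    by rewrite rr; field; rewrite ?n1 ?n2 ?n3 ?n4 ?n5 ?n6.
  have <- : wb * (rm / (1 + rm) / (1 + wa)) * ((1 + rm) * (1 + wa) * (1 + rab)) / rab =
      wa * rm * (1 + rab).
    by rewrite -c1; field; rewrite ?n1 ?n2 ?n3 ?n4 ?n5 ?n6.
  by rewrite e1; field; rewrite ?n1 ?n2 ?n3 ?n4 ?n5 ?n6.
have hB : 2 * (wa * ra) = 1 + wb.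
  have e1 : (1 + ra)^-1 = 2 * wa * (ra / (1 + ra) / (1 + wb)).
    rewrite pp qq.
    have -> : (1 + rab)^-1 = wa * rm / (1 + wa).
      by rewrite -hA mulrC; field; rewrite n1 gt_eqF // gt_eqF.
    by field; rewrite ?n1 ?n2 ?n3 ?n4 ?n5 ?n6.
  have <- : 2 * wa * (ra / (1 + ra) / (1 + wb)) * ((1 + ra) * (1 + wb)) = 2 * (wa * ra).
    by field; rewrite ?n1 ?n2 ?n3 ?n4 ?n5 ?n6.
  by rewrite -e1 mulKf.
split; last by rewrite -c3 -hB; field.
rewrite -c2' -hA -c1; field.
by rewrite ?gt_eqF ?addr_gt0 ?mulr_gt0 ?andbT.
Qed.

(** Seen from a point [P] off the line through [x] and [y], the weight along this line is midpoint
    affine and positive, hence takes equal values at [x] and [y]; the cocycle relation then gives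
    ratio 1. *)
Let mid_phi x y : x <> y -> rho x y = 1.
Proof.
move=> xy; have [v vE] : exists v, v = 2^-1 *: (y - x) by exists (2^-1 *: (y - x)).
have vn : v <> 0.
  rewrite vE => /eqP; rewrite scaler_eq0 invr_eq0 pnatr_eq0 /= subr_eq0 => /eqP yx.
  exact: xy.
have [i vi] := rV_neq0 vn.
have [j ji] := ord_neq i c2.
(* [P] is off the line because [delta_mx 0 j] vanishes in coordinate [i], where [v] does not. *)
pose P : E := x + delta_mx 0 j.
pose X (t : R) := x + t *: v.
have ncX s t : s != t -> noncollinear P (X s) (X t).
  move=> st p q e.
  have := congr1 (fun w : E => w 0 i) e; have := congr1 (fun w : E => w 0 j) e.
  rewrite !mxE !eqxx /= [i == j]eq_sym (negPf ji) /= => ej ei.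
  have e1 : p * s + q * t = 0 by apply: (mulIf vi); rewrite mul0r -[RHS]ei; ring.
  have e2 : p + q = 0.
    have : (p * s + q * t) * v 0 j - (p + q) = 0 by rewrite -[RHS]ej; ring.
    by rewrite e1 mul0r sub0r => /eqP; rewrite oppr_eq0 => /eqP.
  have qE : q = - p by lra.
  have p0 : p = 0.
    have sn : s - t != 0 by rewrite subr_eq0.
    by apply: (mulIf sn); rewrite mul0r -[RHS]e1 qE; ring.
  by rewrite qE p0 oppr0.
pose f t := rho P (X t).
have fmid s t : s != t -> f ((s + t) / 2) = (f s + f t) / 2.
  move=> st; rewrite /f; have -> : X ((s + t) / 2) = mid (X s) (X t).
    by apply/rowP => k; rewrite !mxE; field.
  have [e1 _] := step (ncX _ _ st).
  have ts : t != s by rewrite eq_sym.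
  have [_ e2] := step (ncX _ _ ts).
  have fs := rho_gt0 P (X s); have ft := rho_gt0 P (X t).
  have n1 : rho P (X s) + rho P (X t) != 0 by rewrite gt_eqF // addr_gt0.
  rewrite -(divfK n1 (rho P (mid _ _))) e1 e2; field.
  by rewrite gt_eqF // addr_gt0.
have farith (s0 d : R) n : d != 0 ->
    f (s0 + n.+2%:R * d) - f (s0 + n.+1%:R * d) = f (s0 + n.+1%:R * d) - f (s0 + n%:R * d).
  move=> d0; have <- : (s0 + n.+2%:R * d + (s0 + n%:R * d)) / 2 = s0 + n.+1%:R * d.
    by rewrite -[n.+2%:R]natr1 -[n.+1%:R]natr1; field.
  rewrite fmid; first by field.
  rewrite -subr_eq0 (_ : _ - _ = 2 * d); last by rewrite -[n.+2%:R]natr1 -[n.+1%:R]natr1; ring.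
  by rewrite mulf_neq0 // pnatr_eq0.
(* Both signs of [d] are allowed, so this inequality yields equality below. *)
have fle s0 d : d != 0 -> f s0 <= f (s0 + d).
  move=> d0.
  have := @affine_seq_nondecr R (fun n => f (s0 + n%:R * d)) (fun n => rho_gt0 _ _)
     (fun n => farith s0 d n d0).
  by rewrite mul0r addr0 mul1r.
have f02 : f 0 = f 2.
  apply/eqP; rewrite eq_le; apply/andP; split.
    by have := fle 0 2; rewrite add0r; apply; rewrite pnatr_eq0.
  by have := fle 2 (- 2); rewrite subrr; apply; rewrite oppr_eq0 pnatr_eq0.
have h02 : (0 : R) != 2 by rewrite eq_sym pnatr_eq0.
have := rho_cocycle (ncX _ _ h02).
rewrite -/(f 0) -/(f 2) -f02 /X scale0r addr0.
have -> : x + 2 *: v = y by rewrite vE; apply/rowP => k; rewrite !mxE; field.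
by move=> e; apply: (mulfI (_ : f 0 != 0)); [rewrite gt_eqF // rho_gt0|rewrite mulr1].
Qed.

Lemma phi_mid x y : phi (mid x y) = mid (phi x) (phi y).
Proof.
have [<-|xy] := pselect (x = y).
  have e z : mid z z = z by apply/rowP => i; rewrite !mxE; lra.
  by rewrite !e.
rewrite rhoE mid_phi // scale1r; congr (_ *: _); lra.
Qed.

Let f x := phi x - phi 0.

Let f0 : f 0 = 0. Proof. exact: subrr. Qed.

Let fhalf x y : f (mid x y) = mid (f x) (f y).
Proof. by rewrite /f phi_mid; apply/rowP => i; rewrite !mxE; lra. Qed.

Let f2 x : f (2 *: x) = 2 *: f x.
Proof.
have := fhalf (2 *: x) 0; rewrite f0 /mid !addr0 scalerA mulVf ?pnatr_eq0 // scale1r.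
by move=> ->; rewrite scalerA divff ?scale1r // pnatr_eq0.
Qed.

Let fD x y : f (x + y) = f x + f y.
Proof.
have -> : x + y = 2 *: mid x y by rewrite scalerA divff ?scale1r // pnatr_eq0.
by rewrite f2 fhalf scalerA divff ?scale1r // pnatr_eq0.
Qed.

Let fN x : f (- x) = - f x.
Proof. by apply/eqP; rewrite -addr_eq0 -fD addNr f0. Qed.

Let fn n x : f (n%:R *: x) = n%:R *: f x.
Proof.
elim: n => [|n IH]; first by rewrite !scale0r f0.
by rewrite -natr1 !scalerDl !scale1r fD IH.
Qed.

Let fbetween t x : 0 <= t -> t <= 1 ->
  exists s, [/\ 0 <= s, s <= 1 & f (t *: x) = s *: f x].
Proof.
rewrite le_eqVlt => /predU1P[<- _|t0].
  by exists 0; rewrite !scale0r f0; split.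
rewrite le_eqVlt => /predU1P[->|t1].
  by exists 1; rewrite !scale1r; split.
have [s [s0 s1 e]] := phi_between 0 x t0 t1.
exists s; split; [exact: ltW|exact: ltW|].
rewrite /f; rewrite scaler0 add0r in e; rewrite e.
by apply/rowP => i; rewrite !mxE; ring.
Qed.

(** Additivity treats the integer part of [t], betweenness the fractional part. *)
Let fpos t x : 0 <= t -> exists s, `|s - t| <= 1 /\ f (t *: x) = s *: f x.
Proof.
move=> t0; pose n := Num.truncn t.
have /andP[nt tn] := truncn_itv t0.
have [||s [s0 s1 e]] := @fbetween (t - n%:R) x; rewrite ?subr_ge0 //.
  by rewrite lerBlDr addrC natr1 ltW.
exists (n%:R + s); split.
  rewrite ler_norml; move: nt tn; rewrite -/n -natr1 => ? ?.
  by apply/andP; split; lra.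
by rewrite scalerDl -fn -e -fD -scalerDl addrC subrK.
Qed.

(** By additivity the error at [n * t] is [n] times the error at [t], whereas [fpos] bounds it
    independently of [n]. *)
Let fZpos t x : 0 <= t -> f (t *: x) = t *: f x.
Proof.
move=> t0; apply/eqP; rewrite -subr_eq0; apply/eqP/rowP => i; rewrite [RHS]mxE.
pose D : E := f (t *: x) - t *: f x; change (D 0 i = 0).
apply/eqP; rewrite -normr_le0 leNgt; apply/negP => D0.
pose n := Num.bound (`|f x 0 i| / `|D 0 i|).
have : `|f x 0 i| / `|D 0 i| < n%:R by apply: archi_boundP; rewrite divr_ge0.
rewrite ltr_pdivrMr // ltNge => /negP; apply.
have [s [s1 sE]] := @fpos (n%:R * t) x (mulr_ge0 (ler0n _ _) t0).
rewrite -[n%:R]normr_nat -normrM.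
have -> : n%:R * D 0 i = (s - n%:R * t) * f x 0 i.
  have : n%:R *: D = (s - n%:R * t) *: f x.
    by rewrite /D [LHS]scalerBr -fn scalerA sE scalerBl !scalerA.
  by move=> /(congr1 (fun w : E => w 0 i)); rewrite !mxE.
by rewrite normrM ler_piMl.
Qed.

Lemma phi_affine : exists A : 'M[R]_c, forall x, phi x = x *m A + phi 0.
Proof.
have fZ t x : f (t *: x) = t *: f x.
  have [t0|/ltW t0] := leP 0 t; first exact: fZpos.
  by rewrite -[in LHS](opprK t) scaleNr fN fZpos ?oppr_ge0 // scaleNr opprK.
exists (\matrix_i f (delta_mx 0 i)) => x.
suff -> : x *m (\matrix_i f (delta_mx 0 i)) = f x by rewrite /f subrK.
rewrite mulmx_sum_row [in RHS](row_sum_delta x).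
rewrite (big_morph f fD f0); apply: eq_bigr => i _.
by rewrite rowK fZ.
Qed.

End affine.

(** * Finite convex functions, linear minorants and maxima *)

Section Cvx00_members.
Context {R : realType} {c : nat}.
Local Notation E := 'rV[R]_c.
Implicit Types (q y : E) (s : R).

Definition convex_fun (f : E -> R) := forall x y t, 0 <= t -> t <= 1 ->
  f ((1 - t) *: x + t *: y) <= (1 - t) * f x + t * f y.

Lemma Cvx00_fin (f : E -> R) :
  (forall a : R, open [set x | a < f x]) -> convex_fun f -> f 0 = 0 ->
  Cvx00 (EFin \o f).
Proof.
move=> of_ cf f0; left; split; last by rewrite /= f0.
left; split; first by move=> x; exact: ltNyr.
split.
  move=> x a /=; rewrite lte_fin => ax.
  exists [set x | a < f x]; first exact: open_nbhs_nbhs.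
  by move=> y /=; rewrite lte_fin.
move=> x y t t0 t1 /=; rewrite -!EFinM -EFinD lee_fin.
have := cf y x t (ltW t0) (ltW t1).
by rewrite addrC [X in _ <= X -> _]addrC.
Qed.

Lemma open_dotp_gt q s a : open [set y : E | a < dotp q y - s].
Proof.
rewrite (_ : [set y | _] = (fun y => dotp q y) @^-1` [set r | a + s < r]).
  by apply: open_comp; [move=> *; exact: dotp_continuous|exact: open_gt].
by apply/seteqP; split=> y /=; lra.
Qed.

Lemma convex_fun_dotp q s : convex_fun (fun y => dotp q y - s).
Proof. by move=> x y t _ _; rewrite !dotpE; lra. Qed.

Lemma Cvx00_dotp q : Cvx00 (fun y : E => (dotp q y)%:E).
Proof.
apply: (@Cvx00_fin (fun y => dotp q y)); last by rewrite dotp0r.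
  move=> a; rewrite (_ : [set x | _] = [set y | a < dotp q y - 0]).
    exact: open_dotp_gt.
  by apply/seteqP; split=> y /=; rewrite subr0.
by move=> x y t t0 t1; have := @convex_fun_dotp q 0 x y t t0 t1; rewrite !subr0.
Qed.

(** An affine function with constant [- s] has the wrong value at 0 when [s] is positive; the
    maximum with a linear function repairs this. *)
Lemma Cvx00_max_dotp q0 q s : 0 <= s ->
  Cvx00 (fun y : E => (Num.max (dotp q0 y) (dotp q y - s))%:E).
Proof.
move=> s0; apply: (@Cvx00_fin (fun y => Num.max (dotp q0 y) (dotp q y - s))).
- move=> a; rewrite (_ : [set x | _] =
    [set y | a < dotp q0 y - 0] `|` [set y | a < dotp q y - s]).
    by apply: openU; exact: open_dotp_gt.
  by apply/seteqP; split=> y /=; rewrite lt_max subr0 => /orP.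
- move=> x y t t0 t1; rewrite ge_max; apply/andP; split.
    have := @convex_fun_dotp q0 0 x y t t0 t1; rewrite !subr0 => /le_trans; apply.
    by apply: lerD; apply: ler_wpM2l; rewrite ?subr_ge0 // le_max lexx.
  apply: le_trans (@convex_fun_dotp q s x y t t0 t1) _.
  by apply: lerD; apply: ler_wpM2l; rewrite ?subr_ge0 // le_max lexx orbT.
- by rewrite !dotp0r sub0r; apply/max_idPl; rewrite oppr_le0.
Qed.

(** The subdifferential at 0 of a maximum is made of convex combinations. The factors [l] and
    [1 - l] are not divided out, so that the extreme cases are included. *)
Lemma subgradient_max (f h : E -> R) e : convex_fun f -> convex_fun h ->
  f 0 = 0 -> h 0 = 0 -> (forall y, dotp e y <= Num.max (f y) (h y)) ->
  exists l xi, [/\ 0 <= l, l <= 1,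
    forall a, dotp (l *: e + xi) a <= l * f a &
    forall a, dotp ((1 - l) *: e - xi) a <= (1 - l) * h a].
Proof.
move=> cf ch f0 h0 efh.
pose f' y := f y - dotp e y; pose h' y := h y - dotp e y.
have cf' : convex_fun f'.
  by move=> x y t t0 t1; have := cf x y t t0 t1; rewrite /f' !dotpE; lra.
have ch' : convex_fun h'.
  by move=> x y t t0 t1; have := ch x y t t0 t1; rewrite /h' !dotpE; lra.
pose em (p : E) (r : R) : 'rV[R]_(c + 1) := row_mx p r%:M.
have emE (x : 'rV[R]_(c + 1)) : x = em (lsubmx x) (rsubmx x 0 0).
  by rewrite /em -mx11_scalar hsubmxK.
have em_inj p r p' r' : em p r = em p' r' -> p = p' /\ r = r'.
  move=> /eq_row_mx[-> /(congr1 (fun w : 'M_1 => w 0 0))].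
  by rewrite !mxE !mulr1n.
have em_dot a b p q : dotp (em p a) (em q b) = dotp p q + a * b.
  rewrite {1}/dotp big_split_ord /= big_ord1 /em.
  rewrite !row_mxEr !mxE !mulr1n; congr (_ + _).
  by apply: eq_bigr => i _; rewrite !row_mxEl.
(* Hahn-Banach for a perturbed minimisation of the maximum: [p] shifts the argument of [f'] against
   that of [h'], and [r] shifts its value. The coefficient of [r] is the multiplier [l]. *)
have [|x|rho|z zP] := @hahn_banach R (c + 1) (fun x rho => exists v p r,
    [/\ x = em p r, f' (p + v) + r <= rho & h' v <= rho]).
- move=> x y rho s t [v1 [p1 [r1 [-> a1 b1]]]] [v2 [p2 [r2 [-> a2 b2]]]] t0 t1.
  have t1' : 0 <= 1 - t by rewrite subr_ge0.
  exists ((1 - t) *: v1 + t *: v2), ((1 - t) *: p1 + t *: p2),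
    ((1 - t) * r1 + t * r2); split.
  + rewrite /em !scale_row_mx add_row_mx; congr row_mx.
    by apply/matrixP => i j; rewrite !ord1 !mxE eqxx !mulr1n.
  + have -> : (1 - t) *: p1 + t *: p2 + ((1 - t) *: v1 + t *: v2) =
      (1 - t) *: (p1 + v1) + t *: (p2 + v2) by rewrite !scalerDr addrACA.
    have := cf' (p1 + v1) (p2 + v2) t t0 t1.
    have := ler_wpM2l t1' a1; have := ler_wpM2l t0 a2; lra.
  + have := ch' v1 v2 t t0 t1.
    have := ler_wpM2l t1' b1; have := ler_wpM2l t0 b2; lra.
- rewrite (emE x); move: (lsubmx x) (rsubmx x 0 0) => p r.
  exists (Num.max (f' (p + 0) + r) (h' 0)), 0, p, r.
  by split; rewrite // le_max lexx ?orbT.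
- move=> [v [p [r [e0 a b]]]].
  have [p0 r0] : p = 0 /\ r = 0.
    by apply: em_inj; rewrite -e0 /em raddf0 row_mx0.
  rewrite p0 r0 add0r addr0 in a.
  have := efh v; rewrite le_max => /orP[]; move: a b; rewrite /f' /h'; lra.
pose l := rsubmx z 0 0; pose xi := lsubmx z.
have zP' v p r rho : f' (p + v) + r <= rho -> h' v <= rho ->
    dotp xi p + l * r <= rho.
  by move=> a b; rewrite -em_dot -emE; apply: zP; exists v, p, r.
have f'0 : f' 0 = 0 by rewrite /f' f0 dotp0r subr0.
have h'0 : h' 0 = 0 by rewrite /h' h0 dotp0r subr0.
exists l, xi.
have key a v : dotp xi a - l * f' a <= dotp xi v + (1 - l) * h' v.
  have := zP' v (a - v) (h' v - f' a) (h' v); rewrite subrK.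
  rewrite addrC subrK lexx => /(_ isT isT); rewrite !dotpE; lra.
split.
- have := zP' 0 0 (-1) 0; rewrite addr0 f'0 h'0 !dotpE lexx add0r lerN10 => hl.
  by have := hl isT isT; lra.
- have := zP' 0 0 1 1; rewrite addr0 f'0 h'0 !dotpE add0r lexx ler01 => hl.
  by have := hl isT isT; lra.
- by move=> a; have := key a 0; rewrite h'0 !dotpE /f'; lra.
- by move=> a; have := key 0 a; rewrite f'0 !dotpE /h'; lra.
Qed.

(** The support function of a compact set grows at most linearly, and it bounds [g] from above. *)
Lemma Cvx00_near_fin kappa (g : E -> \bar R) :
  Cvx00_near kappa g -> g <> @ninfty_fun R c ->
  exists f : E -> R, [/\ g = EFin \o f, convex_fun f, f 0 = 0 &
    exists B, forall y, f y <= B * \sum_i `|y 0 i|].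
Proof.
move=> [Cg [_ [K [kK _] <-] gK]] gN.
have [B _ BP] := compact_coord_bounded kK.
have Kle y : (support_fun K y <= (B * \sum_i `|y 0 i|)%:E)%E.
  apply: ge_ereal_sup => _ [x Kx <-]; rewrite lee_fin mulr_sumr.
  apply: ler_sum => i _; apply: le_trans (ler_norm _) _.
  by rewrite normrM ler_wpM2r // BP.
case: Cg => [[[[gl [_ gc]]|//] g0]|//].
have gE y : g y = (fine (g y))%:E.
  rewrite fineK // fin_numElt gl /=; apply: le_lt_trans (ltry _).
  exact: le_trans (proj2 (gK y)) (Kle y).
exists (fine \o g); split.
- by apply/funext => y /=; rewrite -gE.
- move=> x y t; rewrite le_eqVlt => /predU1P[<- _|t0].
    by rewrite subr0 scale1r scale0r addr0 mul1r mul0r addr0.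
  rewrite le_eqVlt => /predU1P[->|t1].
    by rewrite subrr scale1r scale0r add0r mul1r mul0r add0r.
  have := gc y x t t0 t1; rewrite gE (gE x) (gE y) -!EFinM -EFinD lee_fin /=.
  by rewrite addrC [X in _ <= X -> _]addrC.
- by rewrite /= g0.
- exists B => y; rewrite -lee_fin /= -gE.
  exact: le_trans (proj2 (gK y)) (Kle y).
Qed.

End Cvx00_members.

(** * Spanning families, and uncountability of an interval *)

Lemma basis_or_normal (R : realType) (c : nat) (V : set 'rV[R]_c) :
  (exists2 A : 'M[R]_c, A \in unitmx & forall i, V (row i A)) \/
  (exists2 n : 'rV[R]_c, n <> 0 & forall v, V v -> dotp n v = 0).
Proof.
have [|nV] := pselect (exists2 n : 'rV[R]_c, n <> 0 & forall v, V v -> dotp n v = 0).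
  by right.
left.
(* Fewer than [c] vectors have a common normal [n]; a member of [V] not orthogonal to [n] extends
   the free family. *)
have free k : (k <= c)%N ->
    exists2 A : 'M[R]_(k, c), row_free A & forall i, V (row i A).
  elim: k => [_|k IH kc]; first by exists 0; [rewrite /row_free mxrank0|case].
  have [A rA VA] := IH (ltnW kc).
  have /rowV0Pn[n /sub_kermxP nA n0] : kermx A^T != 0.
    rewrite -mxrank_eq0 mxrank_ker mxrank_tr.
    by move: rA; rewrite /row_free => /eqP ->; rewrite subn_eq0 -ltnNge.
  have [w Vw nw] : exists2 w, V w & dotp n w != 0.
    apply: contrapT => h; apply: nV; exists n; first by apply/eqP.
    move=> w Vw; apply: contrapT => nw; apply: h; exists w => //; exact/eqP.
  have nAi i : dotp n (row i A) = 0.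
    have := congr1 (fun M : 'rV[R]_k => M 0 i) nA; rewrite [RHS]mxE => <-.
    by rewrite mxE; apply: eq_bigr => j _; rewrite !mxE.
  exists (col_mx w A : 'M[R]_(1 + k, c)).
    apply: inj_row_free => v0; move: (v0 : 'rV[R]_(1 + k)) => {v0} v.
    change (v *m (col_mx w A : 'M[R]_(1 + k, c)) = 0 -> v = 0).
    rewrite -{1}[v]hsubmxK mul_row_col => e.
    have vl : lsubmx v = 0.
      apply/matrixP => i j; rewrite !ord1 [RHS]mxE.
      have := congr1 (dotp n) e; rewrite dotp0r dotpDr.
      have -> : dotp n (rsubmx v *m A) = 0.
        rewrite mulmx_sum_row dotp_sumr big1 // => k' _.
        by rewrite dotpZr nAi mulr0.
      rewrite [lsubmx v]mx11_scalar mul_scalar_mx dotpZr addr0 => /eqP.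
      by rewrite mulf_eq0 (negPf nw) orbF => /eqP ->; rewrite mxE.
    rewrite vl mul0mx add0r in e.
    rewrite -[v]hsubmxK vl.
    by rewrite (row_free_inj rA (_ : rsubmx v *m A = 0 *m A)) ?row_mx0 // e mul0mx.
  move=> i; case: (splitP (i : 'I_(1 + k))) => j ij.
    rewrite (_ : row i _ = w) //; apply/rowP => l; rewrite mxE.
    have -> : i = lshift k j by apply/val_inj.
    by rewrite -[0 in RHS](ord1 j); exact: col_mxEu.
  rewrite (_ : row i _ = row j A) //; apply/rowP => l; rewrite [LHS]mxE [RHS]mxE.
  have -> : i = rshift 1 j by apply/val_inj.
  exact: col_mxEd.
have [A rA VA] := free c (leqnn c).
by exists A; rewrite -?row_free_unit.
Qed.

(** Countable sets are null, whereas the unit interval has measure 1. *)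
Lemma no_injection_itv (R : realType) (T : countType) (f : R -> T) :
  ~ {in `[0, 1] &, injective f}.
Proof.
move=> fi.
have : countable `[(0 : R), 1]%classic.
  apply/countable_injP; exists (pickle \o f) => x y.
  rewrite !inE /= => x01 y01 /(pcan_inj pickleK); exact: fi.
move=> /countable_lebesgue_measure0.
rewrite lebesgue_measure_itv /= lte_fin ltr01 -EFinD subr0 => /eqP.
by rewrite eqe oner_eq0.
Qed.

(** * Affine minorants of the values of the morphism *)

Section lattice_morphism.
Context {R : realType} {kappa : R} {c : nat}.
Local Notation E := 'rV[R]_c.
Local Notation cc := (@compact_convex R c).
Variable Lambda : set E -> E -> \bar R.
Hypothesis Lambda_codom : forall C, cc C -> Cvx00_near kappa (Lambda C).
Hypothesis Lambda_meet : forall C D, cc C -> cc D ->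
  Lambda (C `&` D) = sqcup (Lambda C) (Lambda D).
Hypothesis Lambda_join : forall C D, cc C -> cc D ->
  Lambda (conv_hull (C `|` D)) = sqcap (Lambda C) (Lambda D).
Implicit Types (C D : set E) (q x y : E) (s : R).

Lemma Lambda_cap_lel C D y : cc C -> cc D ->
  (Lambda (C `&` D) y <= Lambda C y)%E.
Proof.
move=> cC cD; rewrite Lambda_meet //.
by have [[_ [/lefP h _]] _] := sqcupP (Lambda C) (Lambda D); exact: h.
Qed.

Lemma Lambda_cap_greatest C D h : cc C -> cc D -> Cvx00 h ->
  (forall y, (h y <= Lambda C y)%E) -> (forall y, (h y <= Lambda D y)%E) ->
  forall y, (h y <= Lambda (C `&` D) y)%E.
Proof.
move=> cC cD Ch hC hD; rewrite Lambda_meet //.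
have [_ ub] := sqcupP (Lambda C) (Lambda D).
by apply/lefP/ub; split=> //; split; exact/lefP.
Qed.

Lemma Lambda_mono C D : cc C -> cc D -> C `<=` D ->
  forall y, (Lambda C y <= Lambda D y)%E.
Proof.
by move=> cC cD /setIidPr CD y; rewrite -{1}CD; exact: Lambda_cap_lel.
Qed.

(** The pointwise maximum belongs to [Cvx00], so it is an upper bound that competes in the
    definition of [sqcap]. *)
Lemma Lambda_hull C D y : cc C -> cc D ->
  (Lambda (conv_hull (C `|` D)) y <= maxe (Lambda C y) (Lambda D y))%E.
Proof.
move=> cC cD; rewrite Lambda_join //.
have [CC _] := Lambda_codom cC; have [CD _] := Lambda_codom cD.
have [_ lb] := sqcapP CC CD.
pose h y := ereal_sup [set g y | g in [set Lambda C; Lambda D]].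
have : (sqcap (Lambda C) (Lambda D) <= h)%O.
  apply: lb; split; first by apply: Cvx00_sup => g [] ->.
  by split; apply/lefP => p; apply: ereal_sup_ubound => /=;
    [exists (Lambda C) => //; left|exists (Lambda D) => //; right].
move=> /lefP /(_ y) /le_trans; apply.
by apply: ge_ereal_sup => _ [g [] -> <-]; rewrite le_max lexx ?orbT.
Qed.

Lemma Lambda_seg x y w p : seg x y w ->
  (Lambda [set w] p <= maxe (Lambda [set x] p) (Lambda [set y] p))%E.
Proof.
move=> xyw; apply: le_trans (Lambda_hull _ (point_cc _) (point_cc _)).
rewrite conv_hull2; apply: Lambda_mono; [exact: point_cc|exact: seg_cc|].
by move=> _ ->.
Qed.

Lemma Lambda_fin C : cc C -> Lambda C <> @ninfty_fun R c ->
  exists f : E -> R, [/\ Lambda C = EFin \o f, convex_fun f, f 0 = 0 &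
    exists B, forall y, f y <= B * \sum_i `|y 0 i|].
Proof. by move=> cC; apply: (@Cvx00_near_fin _ _ kappa); exact: Lambda_codom. Qed.

(** Phrased by affine minorants, so that no conjugate function with extended values has to be
    formed. *)
Definition conj_epi C q s := forall y, ((dotp q y - s)%:E <= Lambda C y)%E.

Definition conj_zero C : set E := [set q | conj_epi C q 0].

Lemma conj_epi_fin C q s : cc C -> conj_epi C q s ->
  exists f : E -> R, [/\ Lambda C = EFin \o f, convex_fun f, f 0 = 0 &
    exists B, forall y, f y <= B * \sum_i `|y 0 i|].
Proof.
by move=> cC Eq; apply: Lambda_fin => // CN; have := Eq 0; rewrite CN.
Qed.

Lemma conj_epi_mono C D q s :
  cc C -> cc D -> C `<=` D -> conj_epi C q s -> conj_epi D q s.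
Proof. by move=> cC cD CD Eq y; exact: le_trans (Eq y) (Lambda_mono cC cD CD y). Qed.

Lemma conj_epi_ge0 C q s : cc C -> conj_epi C q s -> 0 <= s.
Proof.
move=> cC Eq; have [f [fE _ f0 _]] := conj_epi_fin cC Eq.
by have := Eq 0; rewrite fE /= f0 dotp0r sub0r lee_fin oppr_le0.
Qed.

Lemma conj_epi_up C q s s' : s <= s' -> conj_epi C q s -> conj_epi C q s'.
Proof. by move=> ss Eq y; apply: le_trans (Eq y); rewrite lee_fin; lra. Qed.

Lemma conj_epi_conv C q s q' s' t : cc C -> conj_epi C q s -> conj_epi C q' s' ->
  0 <= t -> t <= 1 -> conj_epi C ((1 - t) *: q + t *: q') ((1 - t) * s + t * s').
Proof.
move=> cC Eq Eq' t0 t1 y; have [f [fE _ _ _]] := conj_epi_fin cC Eq.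
have := Eq y; have := Eq' y; rewrite fE /= !lee_fin !dotpE => a b.
have t1' : 0 <= 1 - t by rewrite subr_ge0.
by have := ler_wpM2l t1' b; have := ler_wpM2l t0 a; lra.
Qed.

Lemma conj_epi_bounded C : cc C -> exists B, forall q s, conj_epi C q s ->
  forall i, `|q 0 i| <= B.
Proof.
move=> cC; have [CN|CN] := pselect (Lambda C = @ninfty_fun R c).
  by exists 0 => q s /(_ 0); rewrite CN.
have [f [fE _ _ [B BP]]] := Lambda_fin cC CN.
pose B' := Num.max B 0.
have B'0 : 0 <= B' by rewrite le_max lexx orbT.
exists B' => q s Eq i; rewrite leNgt; apply/negP => Bq.
have s0 := conj_epi_ge0 cC Eq.
have d0 : 0 < `|q 0 i| - B' by rewrite subr_gt0.
(* At distance [T] along the axis, a slope beyond [B'] would exceed the linear growth bound by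
   [s + 1], which is more than [s]. *)
pose T := (s + 1) / (`|q 0 i| - B').
have T0 : 0 <= T by apply: divr_ge0; [exact: addr_ge0|exact: ltW].
pose a := Num.sg (q 0 i) * T.
have aT : `|a| <= T.
  rewrite normrM (ger0_norm T0) normr_sg; case: eqP => _; rewrite ?mul1r //.
  by rewrite mul0r.
have := Eq (a *: delta_mx 0 i); rewrite fE lee_fin /= => /le_trans /(_ (BP _)).
have -> : \sum_j `|(a *: (delta_mx 0 i : E)) 0 j| = `|a|.
  rewrite (bigD1 i) //= big1 ?addr0; first by rewrite !mxE !eqxx mulr1.
  by move=> j /negPf ji; rewrite !mxE ji andbF mulr0 normr0.
rewrite dotpZr dotp_delta /a mulrAC -normrEsg -/a => h.
have h1 : B * `|a| <= B' * T.
  apply: (@le_trans _ _ (B' * `|a|)); last exact: ler_wpM2l.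
  by rewrite ler_wpM2r // le_max lexx.
have : T * (`|q 0 i| - B') <= s by move: h h1; rewrite mulrBr; lra.
by rewrite divfK ?gt_eqF // gerDl ler10.
Qed.

Lemma conj_epi_subgradient C f y : cc C -> Lambda C = EFin \o f -> convex_fun f ->
  exists q s, conj_epi C q s /\ f y = dotp q y - s.
Proof.
move=> cC fE cf; have [z zP] := @subgradient R c f y cf.
exists z, (dotp z y - f y); split; last by lra.
by move=> p; rewrite fE lee_fin; have := zP p; rewrite !dotpE; lra.
Qed.

(** Take a subgradient at 0: the value there is 0, so its constant vanishes. *)
Lemma conj_zero_neq0 C :
  cc C -> Lambda C <> @ninfty_fun R c -> exists q, conj_zero C q.
Proof.
move=> cC CN; have [f [fE cf f0 _]] := Lambda_fin cC CN.
have [q [s [Eq e]]] := conj_epi_subgradient 0 cC fE cf; exists q.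
have s0 : s = 0 by move: e; rewrite f0 dotp0r; lra.
by rewrite s0 in Eq.
Qed.

Lemma conj_zero_cap C D q :
  cc C -> cc D -> conj_zero C q -> conj_zero D q -> conj_zero (C `&` D) q.
Proof.
move=> cC cD ZC ZD y; rewrite subr0.
apply: (Lambda_cap_greatest cC cD (Cvx00_dotp q)) => p.
  by have := ZC p; rewrite subr0.
by have := ZD p; rewrite subr0.
Qed.

(** The maximum of the common zero and the affine minorant belongs to [Cvx00] and lies below both
    values, hence below their meet. *)
Lemma conj_epi_cap C D q0 q s : cc C -> cc D -> conj_zero C q0 -> conj_zero D q0 ->
  conj_epi C q s -> conj_epi D q s -> conj_epi (C `&` D) q s.
Proof.
move=> cC cD ZC ZD EC ED y; have s0 := conj_epi_ge0 cC EC.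
apply: (@le_trans _ _ (Num.max (dotp q0 y) (dotp q y - s))%:E).
  by rewrite lee_fin le_max lexx orbT.
apply: (Lambda_cap_greatest cC cD (Cvx00_max_dotp q0 q s0)) => p.
  rewrite EFin_max ge_max EC andbT; by have := ZC p; rewrite subr0.
rewrite EFin_max ge_max ED andbT; by have := ZD p; rewrite subr0.
Qed.

Lemma conj_zero_cap_morphism : cap_morphism conj_zero.
Proof.
split.
- move=> C cC x y t Zx Zy t0 t1.
  by have := conj_epi_conv cC Zx Zy t0 t1; rewrite !mulr0 addr0.
- by move=> C D cC cD CD q; exact: conj_epi_mono.
- by move=> C D cC cD q [ZC ZD]; exact: conj_zero_cap.
Qed.

Lemma conj_zero_closed C q z : cc C ->
  (forall s, 0 <= s -> s < 1 -> conj_zero C ((1 - s) *: q + s *: z)) -> conj_zero C z.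
Proof.
move=> cC h; have [f [fE _ _ _]] := conj_epi_fin cC (h 0 (lexx _) ltr01).
move=> y; rewrite subr0 fE lee_fin /= leNgt; apply/negP => fz.
have hy s : 0 <= s -> s < 1 -> (1 - s) * dotp q y + s * dotp z y <= f y.
  by move=> s0 s1; have := h s s0 s1 y; rewrite subr0 fE lee_fin /= !dotpE.
have := hy 0 (lexx _) ltr01; rewrite subr0 mul1r mul0r addr0 => qy.
pose a := dotp z y - f y; pose b := f y - dotp q y.
have a0 : 0 < a by rewrite subr_gt0.
have b0 : 0 <= b by rewrite subr_ge0.
(* The inequality at [s] amounts to [s * (a + b) <= b]; this [s < 1] violates it by [a / 2]. *)
pose s := (a / 2 + b) / (a + b).
have ab : 0 < a + b by rewrite ltr_wpDr.
have s0 : 0 <= s by apply: divr_ge0; [lra|exact: ltW].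
have s1 : s < 1 by rewrite ltr_pdivrMr // mul1r; lra.
have := hy s s0 s1.
have -> : (1 - s) * dotp q y + s * dotp z y = dotp q y + s * (a + b).
  by rewrite /a /b; ring.
by rewrite divfK ?gt_eqF // /a /b; lra.
Qed.

(** [Lambda [set w]] is at most the maximum of the values at the end points, so [e] is a subgradient
    of this maximum at 0 and splits by [subgradient_max]. *)
Lemma conj_zero_seg x y w e : x <> w -> y <> w -> (forall q, ~ conj_zero set0 q) ->
  seg x y w -> conj_zero [set w] e ->
  exists a b s, [/\ conj_zero [set x] a, conj_zero [set y] b, 0 < s, s < 1 &
    e = (1 - s) *: a + s *: b].
Proof.
move=> xw yw Z0 xyw Ze.
have le y' : (((dotp e y')%:E) <= maxe (Lambda [set x] y') (Lambda [set y] y'))%E.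
  by apply: le_trans (Lambda_seg _ xyw); have := Ze y'; rewrite subr0.
have disj z : z <> w -> conj_zero [set z] e -> False.
  move=> zw Zz; apply: (Z0 e).
  have <- : [set z] `&` [set w] = set0.
    by apply/seteqP; split=> // p [-> wp]; case: zw.
  by apply: conj_zero_cap => //; exact: point_cc.
(* If one end point went to [-oo], then [e] would be a zero over the other one. *)
have nN (u v : E) : v <> w ->
    (forall y', ((dotp e y')%:E <= maxe (Lambda [set u] y') (Lambda [set v] y'))%E) ->
    Lambda [set u] <> @ninfty_fun R c.
  move=> vw h uN; apply: (disj v vw) => y'; rewrite subr0.
  by apply: le_trans (h y') _; rewrite uN ge_max leNye lexx.
have [f [fE cf f0 _]] := Lambda_fin (point_cc _) (nN _ _ yw le).
have [h [hE ch h0 _]] : exists h : E -> R, [/\ Lambda [set y] = EFin \o h,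
    convex_fun h, h 0 = 0 & exists B, forall y, h y <= B * \sum_i `|y 0 i|].
  by apply: (Lambda_fin (point_cc _)); apply: (nN _ _ xw) => y'; rewrite maxC.
have [l [xi [l0 l1 lf lh]]] : exists l xi, [/\ 0 <= l, l <= 1,
    forall a, dotp (l *: e + xi) a <= l * f a &
    forall a, dotp ((1 - l) *: e - xi) a <= (1 - l) * h a].
  apply: subgradient_max => // y'.
  by have := le y'; rewrite fE hE /= -EFin_max lee_fin.
have zero (v : E) : (forall a, dotp v a <= 0) -> v = 0.
  by move=> hv; apply: dotp_eq0; apply/eqP; rewrite eq_le dotp_ge0 hv.
(* For [l] equal to 0 or 1, [e] would be a zero over [y] or over [x], against disjointness from the
   zeros over [w]. *)
have ln0 : l != 0.
  apply/eqP => l00; apply: (disj y yw) => a; rewrite subr0 hE lee_fin.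
  have xi0 : xi = 0.
    by apply: zero => a'; have := lf a'; rewrite l00 scale0r add0r mul0r.
  by have := lh a; rewrite l00 xi0 !subr0 scale1r mul1r.
have ln1 : 1 - l != 0.
  apply/eqP => l11; apply: (disj x xw) => a; rewrite subr0 fE lee_fin.
  have xi0 : - xi = 0.
    by apply: zero => a'; have := lh a'; rewrite l11 scale0r add0r mul0r.
  have l1' : l = 1 by lra.
  by have := lf a; rewrite -[xi]opprK xi0 oppr0 addr0 l1' scale1r mul1r.
have lgt : 0 < l by rewrite lt_neqAle eq_sym ln0.
have lgt' : 0 < 1 - l by rewrite lt_neqAle eq_sym ln1 subr_ge0.
exists (l^-1 *: (l *: e + xi)), ((1 - l)^-1 *: ((1 - l) *: e - xi)), (1 - l).
split=> //.
- by move=> a; rewrite subr0 fE lee_fin dotpZl mulrC ler_pdivrMr // mulrC.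
- by move=> a; rewrite subr0 hE lee_fin dotpZl mulrC ler_pdivrMr // mulrC.
- by lra.
rewrite subKr !scalerA !divff // !scale1r.
by apply/rowP => i; rewrite !mxE; ring.
Qed.

(** [C] lies in a cube. A face with [k.+1] free coordinates is the hull of two opposite faces with
    [k] free ones, so the bound passes from points to the cube by [Lambda_hull], and monotonicity
    squeezes [Lambda C]. *)
Lemma const_points : (forall x, Lambda [set x] = Lambda set0) ->
  forall C, cc C -> Lambda C = Lambda set0.
Proof.
move=> pts C cC.
have [M M0 CM] := compact_coord_bounded (proj1 cC).
pose I k (v : E) (i : 'I_c) : set R :=
  if (i < k)%N then `[(- M), M]%classic else [set v 0 i].
pose face k v : set E := [set p | forall i, I k v i (p 0 i)].
have faceP k v p : face k v p <->
    forall i : 'I_c, if (i < k)%N then is_true (`|p 0 i| <= M) else p 0 i = v 0 i.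
  split=> h i; have := h i; rewrite /I; case: ifP => // _.
    by rewrite /= in_itv /= ler_norml.
  by rewrite /= in_itv /= ler_norml.
have cface k v : cc (face k v).
  split.
    apply: (@rV_compact R c (I k v)) => i; rewrite /I; case: ifP => _.
      exact: segment_compact.
    exact: compact_set1.
  apply/convex_setE => p q t /faceP hp /faceP hq t0 t1; apply/faceP => i.
  have := hp i; have := hq i; case: ifP => _; last by rewrite !mxE => -> ->; ring.
  rewrite !mxE !ler_norml => /andP[? ?] /andP[? ?].
  by apply/andP; split; nra.
have facele k : (k <= c)%N -> forall v y, (Lambda (face k v) y <= Lambda set0 y)%E.
  elim: k => [_ v y|k IH kc v y].
    have -> : face 0%N v = [set v].
      apply/seteqP; split=> [p /faceP h|_ ->]; last by apply/faceP.
      by apply/rowP => i; have := h i.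
    by rewrite pts.
  pose vs (a : R) : E := \row_i (if i == Ordinal kc then a else v 0 i).
  have hullE : face k.+1 v = conv_hull (face k (vs M) `|` face k (vs (- M))).
    apply/seteqP; split.
      move=> p /faceP hp B [/convex_setE cB sB].
      pose pa (a : R) : E := \row_i (if i == Ordinal kc then a else p 0 i).
      have pface a : face k (vs a) (pa a).
        apply/faceP => i; have := hp i; rewrite !mxE -!val_eqE /= ltnS leq_eqVlt.
        by case: (ltngtP i k).
      have := hp (Ordinal kc); rewrite /= ltnSn ler_norml => /andP[pM1 pM2].
      pose t := (M - p 0 (Ordinal kc)) / (2 * M).
      have M2 : 0 < 2 * M by lra.
      have -> : p = (1 - t) *: pa M + t *: pa (- M).
        apply/rowP => i; rewrite !mxE; case: eqP => [->|_]; last by ring.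
        by rewrite /t; field; rewrite gt_eqF.
      apply: cB; first by apply: sB; left.
      - by apply: sB; right.
      - by apply: divr_ge0; lra.
      - by rewrite ler_pdivrMr //; lra.
    apply: smallest_sub; first by case: (cface k.+1 v).
    have grow (b : R) (p : E) (i : 'I_c) : `|b| <= M ->
        (if (i < k)%N then is_true (`|p 0 i| <= M) else p 0 i = vs b 0 i) ->
        if (i < k.+1)%N then is_true (`|p 0 i| <= M) else p 0 i = v 0 i.
      rewrite !mxE -val_eqE /= ltnS [(i <= k)%N]leq_eqVlt.
      by case: (ltngtP i k) => //= _ bM ->.
    have MM : `|M| <= M by rewrite ger0_norm // ltW.
    move=> p [] /faceP hp; apply/faceP => i; first exact: grow MM (hp i).
    by apply: grow (hp i); rewrite normrN.
  rewrite hullE; apply: le_trans (Lambda_hull _ (cface _ _) (cface _ _)) _.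
  by rewrite ge_max !IH // ltnW.
apply/funext => y; apply/eqP; rewrite eq_le; apply/andP; split.
  apply: le_trans (facele c (leqnn c) 0 y); apply: Lambda_mono => //.
  by move=> p Cp; apply/faceP => i; rewrite ltn_ord; exact: CM.
by apply: Lambda_mono => //; exact: empty_cc.
Qed.

(** * The case where the empty set goes to minus infinity *)

Section empty_to_ninfty.
Hypothesis c2 : (2 <= c)%N.
Hypothesis Lambda0 : Lambda set0 = @ninfty_fun R c.
Hypothesis point_proper : exists x, Lambda [set x] <> @ninfty_fun R c.

Let Z0 q : ~ conj_zero set0 q.
Proof. by move=> /(_ 0); rewrite Lambda0. Qed.

Let Zdisj x y q : conj_zero [set x] q -> conj_zero [set y] q -> x = y.
Proof.
by move=> Zx Zy; exact: (disjoint_points conj_zero_cap_morphism (@Z0) Zx Zy).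
Qed.

(** [b] is the midpoint of [x] and its reflection [2 *: b - x]. If [x] went to [-oo], a zero over
    [b] would also be one over the reflection, forcing [b = x]. *)
Let points_proper x : Lambda [set x] <> @ninfty_fun R c.
Proof.
move=> xN; have [b bN] := point_proper.
have [q Zq] := conj_zero_neq0 (point_cc b) bN.
have bs : seg (2 *: b - x) x b.
  apply/segP; exists 2^-1; split; [lra|lra|].
  by apply/rowP => i; rewrite !mxE; field.
have Zw : conj_zero [set 2 *: b - x] q.
  move=> y; apply: le_trans (Zq y) _; apply: le_trans (Lambda_seg y bs) _.
  by rewrite xN ge_max lexx leNye.
have e := Zdisj Zq Zw; apply: bN; rewrite (_ : b = x) //.
by move: e => /rowP e; apply/rowP => i; have := e i; rewrite !mxE; lra.
Qed.

Let Zbetween o d e : conj_zero [set o] e ->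
  exists r, conj_zero [set o + d] (e + r) /\
    exists2 a, 0 < a & conj_zero [set o - d] (e - a *: r).
Proof.
move=> Ze; have [->|d0] := eqVneq d 0.
  by exists 0; rewrite !addr0 subr0; split=> //; exists 1 => //; rewrite scaler0 subr0.
have d1 : o + d <> o.
  by move=> /eqP; rewrite -subr_eq0 addrAC subrr add0r (negPf d0).
have d2 : o - d <> o.
  by move=> /eqP; rewrite -subr_eq0 addrAC subrr add0r oppr_eq0 (negPf d0).
have os : seg (o + d) (o - d) o.
  apply/segP; exists 2^-1; split; [lra|lra|].
  by apply/rowP => i; rewrite !mxE; field.
have [a [b [s [Za Zb s0 s1 eE]]]] := conj_zero_seg d1 d2 (@Z0) os Ze.
have sn : s != 0 by rewrite gt_eqF.
exists (a - e); rewrite [e + _]addrC subrK; split=> //.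
exists ((1 - s) / s); first by rewrite divr_gt0 // subr_gt0.
rewrite (_ : e - _ = b) //; apply/rowP => i.
by have /rowP /(_ i) := eE; rewrite !mxE => ->; field.
Qed.

Let phi_ex x : exists q, conj_zero [set x] q.
Proof. exact/conj_zero_neq0/points_proper/point_cc. Qed.

Definition phi x := projT1 (cid (phi_ex x)).

Let Zphi x : conj_zero [set x] (phi x).
Proof. by rewrite /phi; case: cid. Qed.

Let conj_zero_uniq x q : conj_zero [set x] q -> q = phi x.
Proof.
apply: (singleton c2 conj_zero_cap_morphism (@Z0) phi_ex Zbetween) (Zphi x).
by move=> o e z; apply: conj_zero_closed; exact: point_cc.
Qed.

Let phi_between x y t : 0 < t -> t < 1 -> exists s, [/\ 0 < s, s < 1 &
  phi ((1 - t) *: x + t *: y) = (1 - s) *: phi x + s *: phi y].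
Proof.
move=> t0 t1; set w := _ + _.
have [xy|xy] := pselect (x = y).
  exists 2^-1; split; [lra|lra|]; rewrite /w xy -!scalerDl !subrK !scale1r //.
have ws : seg x y w by apply/segP; exists t; split=> //; exact: ltW.
have yx : y - x != 0 by rewrite subr_eq0; apply/eqP => yx; apply: xy.
have xw : x <> w.
  move=> /eqP; rewrite eq_sym -subr_eq0 (_ : w - x = t *: (y - x)).
    by rewrite scaler_eq0 (negPf yx) orbF gt_eqF.
  by apply/rowP => i; rewrite !mxE; ring.
have yw : y <> w.
  move=> /eqP; rewrite -subr_eq0 (_ : y - w = (1 - t) *: (y - x)).
    by rewrite scaler_eq0 (negPf yx) orbF subr_eq0 gt_eqF.
  by apply/rowP => i; rewrite !mxE; ring.
have [a [b [s [Za Zb s0 s1 ->]]]] := conj_zero_seg xw yw (@Z0) ws (Zphi w).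
by exists s; split=> //; rewrite (conj_zero_uniq Za) (conj_zero_uniq Zb).
Qed.

(** This is [independence] for two vectors. *)
Let phi_nc P a b : noncollinear P a b -> noncollinear (phi P) (phi a) (phi b).
Proof.
move=> h s t e.
pose sel (T : Type) (u v : T) (i : 'I_2) := if i == 0 then u else v.
pose D : 'M[R]_(2, c) := \matrix_i sel _ (a - P) (b - P) i.
have rD : row_free D.
  apply: inj_row_free => v; rewrite mulmx_sum_row !big_ord_recl big_ord0 addr0.
  rewrite !rowK /sel /= => /h[v0 v1]; apply/rowP => i; rewrite mxE.
  have [->//|] := eqVneq i 0.
  by case: i => -[|[|//]] // i2 _; rewrite -[RHS]v1;
    congr (v 0 _); apply/val_inj.
have f0 : forall i, sel _ s t i = 0.
  apply: (independence conj_zero_cap_morphism (@Z0)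
    (z := sel _ (phi a) (phi b)) rD _ (Zphi P)).
    move=> i; rewrite rowK /sel; case: ifP => _; rewrite [P + _]addrC subrK; exact: Zphi.
  by rewrite !big_ord_recl big_ord0 addr0 /sel /=.
by split; [exact: (f0 0)|exact: (f0 1)].
Qed.

Let phi_inj : injective phi.
Proof. by move=> x y e; apply: (Zdisj (Zphi x)); rewrite e. Qed.

Lemma phi_matrix : exists2 A : 'M[R]_c, A \in unitmx &
  forall x, phi x = x *m A + phi 0.
Proof.
have [A phiA] := phi_affine c2 phi_between phi_nc.
exists A => //; rewrite -row_free_unit; apply: inj_row_free => v vA.
by apply: phi_inj; rewrite phiA vA add0r.
Qed.

(* A slope [q] other than [phi o] would give, for every direction not parallel
   to [q - phi o], slopes arbitrarily far away. *)
Let conj_epi_point o q s : conj_epi [set o] q s -> q = phi o.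
Proof.
move=> Eq; have [A Au phiA] := phi_matrix.
have s0 := conj_epi_ge0 (point_cc o) Eq.
have phiD x y : phi (x + y) = phi x + y *m A.
  by rewrite phiA [in RHS]phiA mulmxDl addrAC.
apply: contrapT => qo.
have [v vA] : exists v, v *m A = q - phi o.
  by exists ((q - phi o) *m invmx A); rewrite mulmxKV.
have [i vi] : exists i, v 0 i != 0.
  apply: rV_neq0 => v0; apply: qo; apply/eqP.
  by rewrite -subr_eq0 -vA v0 mul0mx.
have [j ji] := ord_neq i c2.
have [u ui uj] : exists2 u : E, u 0 i = 0 & u 0 j = 1.
  exists (delta_mx 0 j); last by rewrite mxE !eqxx.
  by rewrite mxE eqxx /= eq_sym (negPf ji).
(* As [u] and [v] are not parallel, [C] and [D] meet only in [o]. The midpoint of [C] and the mean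
   of [(q, s)] with the zero over the far end of [D] have the same slope, because
   [v *m A = q - phi o]. *)
have far N : conj_epi [set o] (phi o + (N / 2) *: (u *m A)) (s / 2).
  pose C := seg o (o + N *: u); pose D := seg o (o + (N *: u - v)).
  have cC : cc C by exact: seg_cc.
  have cD : cc D by exact: seg_cc.
  have pC p x : C p -> conj_epi [set p] x 0 -> conj_epi C x 0.
    by move=> Cp; apply: conj_epi_mono => //; [exact: point_cc|move=> _ ->].
  have pD p x r : D p -> conj_epi [set p] x r -> conj_epi D x r.
    by move=> Dp; apply: conj_epi_mono => //; [exact: point_cc|move=> _ ->].
  have CD : C `&` D `<=` [set o].
    move=> p [/segP[t [t0 t1 pE]] /segP[t' [t'0 t'1 pE']]].
    have t'v : t' * v 0 i = 0.
      have := congr1 (fun w : E => w 0 i) pE; rewrite pE' !mxE ui => h.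
      by move: h; rewrite mulr0; lra.
    have t'00 : t' = 0 by move/eqP: t'v; rewrite mulf_eq0 (negPf vi) orbF => /eqP.
    by rewrite /= pE' t'00 subr0 scale1r scale0r addr0.
  apply: (conj_epi_mono (ccI cC cD) (point_cc o) CD).
  apply: (conj_epi_cap cC cD (q0 := phi o)).
  - by apply: pC (Zphi o); exact: segl.
  - by apply: pD (Zphi o); exact: segl.
  - apply: (@conj_epi_up _ _ 0); first by rewrite divr_ge0.
    apply: (pC (o + (N / 2) *: u)).
      apply/segP; exists 2^-1; split; [lra|lra|].
      by apply/rowP => k; rewrite !mxE; field.
    by rewrite scalemxAl -phiD; exact: Zphi.
  have E1 : conj_epi D q s by apply: pD Eq; exact: segl.
  have E2 : conj_epi D (phi (o + (N *: u - v))) 0 by apply: pD (Zphi _); exact: segr.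
  have h0 : 0 <= 2^-1 :> R by lra.
  have h1 : 2^-1 <= 1 :> R by lra.
  have := conj_epi_conv cD E1 E2 h0 h1.
  have -> : (1 - 2^-1) * s + 2^-1 * 0 = s / 2 by field.
  rewrite phiD mulmxBl vA -scalemxAl; congr (conj_epi D _ _).
  by apply/rowP => k; rewrite !mxE; field.
have [k wk] : exists k, (u *m A) 0 k != 0.
  apply: rV_neq0 => uA0; have := mulmxK Au u; rewrite uA0 mul0mx.
  move=> /(congr1 (fun w : E => w 0 j)); rewrite mxE uj => /eqP.
  by rewrite eq_sym oner_eq0.
have [B BP] := conj_epi_bounded (point_cc o).
(* This [N] pushes the [k]-th coordinate of the new slope beyond the bound [B]. *)
have := BP _ _ (far ((`|B| + `|phi o 0 k| + 1) * 2 / (u *m A) 0 k)) k.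
rewrite !mxE -[\sum_(i0 < c) _](_ : (u *m A) 0 k = _); last by rewrite mxE.
have -> : (`|B| + `|phi o 0 k| + 1) * 2 / (u *m A) 0 k / 2 * (u *m A) 0 k =
  `|B| + `|phi o 0 k| + 1 by field.
move=> /(le_trans (ler_norm _)).
have := ler_norm B; have := ler_norm (- phi o 0 k); rewrite normrN; lra.
Qed.

Let Lambda_point o y : Lambda [set o] y = (dotp (phi o) y)%:E.
Proof.
have [f [fE cf f0 _]] := Lambda_fin (point_cc o) (@points_proper o).
rewrite fE /=; congr _%:E; apply/eqP; rewrite eq_le; apply/andP; split.
  have [q [s [Eq ->]]] := conj_epi_subgradient y (point_cc o) fE cf.
  by rewrite (conj_epi_point Eq) gerBl; exact: conj_epi_ge0 (point_cc o) Eq.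
by have := Zphi o y; rewrite subr0 fE lee_fin.
Qed.

(** If [q = phi p] with [p] outside [C], then [(q, s)] is a minorant for [C] and for the segment
    from [x0] to [p], hence for a segment from [x0] to some [p1] short of [p]. There [Lambda] is at
    most a maximum of two linear functions, which the minorant exceeds far out. *)
Let conj_epi_slope C q s x0 : cc C -> C x0 -> conj_epi C q s -> (phi @` C) q.
Proof.
move=> cC Cx0 Eq; have [A Au phiA] := phi_matrix.
have s0 := conj_epi_ge0 cC Eq.
pose p := (q - phi 0) *m invmx A.
have pq : phi p = q by rewrite phiA mulmxKV // subrK.
have [Cp|Cp] := pselect (C p); first by exists p.
exfalso.
have phiC t x y : phi ((1 - t) *: x + t *: y) = (1 - t) *: phi x + t *: phi y.
  rewrite phiA (phiA x) (phiA y) mulmxDl -!scalemxAl.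
  by apply/rowP => i; rewrite !mxE; ring.
(* [C] is closed and misses [p], so the segment leaves [C] for good before reaching [p]. *)
have [t1 [t10 t11 tP]] : exists t1, [/\ 0 <= t1, t1 < 1 &
    forall t, t <= 1 -> C ((1 - t) *: x0 + t *: p) -> t <= t1].
  have clC : closed C by exact: compact_closed rV_hausdorff (proj1 cC).
  pose g (t : R) : E := (1 - t) *: x0 + t *: p.
  have cg : continuous g.
    move=> t; apply: cvgD; apply: cvgZr_tmp; last exact: cvg_id.
    by apply: cvgB; [exact: cvg_cst|exact: cvg_id].
  have og : open (g @^-1` (~` C)).
    by apply: open_comp; [move=> *; exact: cg|exact: closed_openC].
  have : nbhs (1 : R) (g @^-1` (~` C)).
    apply: open_nbhs_nbhs; split=> //=.
    by rewrite /g subrr scale0r add0r scale1r.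
  move=> /nbhs_ballP[e /= e0 eP].
  exists (Num.max 0 (1 - e / 2)); split.
  - by rewrite le_max lexx.
  - by rewrite gt_max ltr01 /= ltrBlDr ltrDl divr_gt0.
  - move=> t tle Ct; rewrite leNgt gt_max; apply/negP => /andP[t0' te].
    apply: (eP t) Ct; rewrite /ball /= ger0_norm ?subr_ge0 //; lra.
pose p1 := (1 - t1) *: x0 + t1 *: p.
have cS : cc (seg x0 p) by exact: seg_cc.
have sub : C `&` seg x0 p `<=` seg x0 p1.
  move=> r [Cr /segP[t [t0 t1' rE]]].
  have tt1 : t <= t1 by apply: tP => //; rewrite -rE.
  have [t100|t1n] := eqVneq t1 0.
    have t00 : t = 0 by lra.
    by rewrite rE t00 subr0 scale1r scale0r addr0; exact: segl.
  have t1p : 0 < t1 by rewrite lt_neqAle eq_sym t1n.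
  apply/segP; exists (t / t1); split; first by rewrite divr_ge0.
    by rewrite ler_pdivrMr // mul1r.
  by rewrite rE /p1; apply/rowP => i; rewrite !mxE; field.
have inS x r z : seg x0 p x -> conj_epi [set x] z r -> conj_epi (seg x0 p) z r.
  by move=> Sx; apply: conj_epi_mono => //; [exact: point_cc|move=> _ ->].
have E1 : conj_epi (seg x0 p1) q s.
  apply: (conj_epi_mono (ccI cC cS) (seg_cc _ _) sub).
  apply: (conj_epi_cap cC cS (q0 := phi x0)) => //.
  - by apply: conj_epi_mono (Zphi x0) => //; [exact: point_cc|move=> _ ->].
  - by apply: inS (Zphi x0); exact: segl.
  - by apply: (conj_epi_up s0); rewrite -pq; apply: inS (Zphi p); exact: segr.
have [v vE] : exists v, v = q - phi x0 by exists (q - phi x0).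
have v0 : 0 < dotp v v.
  rewrite lt_neqAle dotp_ge0 andbT eq_sym; apply/eqP => /dotp_eq0 /eqP.
  rewrite vE subr_eq0 -pq => /eqP /phi_inj e; apply: Cp; by rewrite e.
(* At [tau *: v] the minorant exceeds both linear functions by at least 1. *)
pose tau := (s + 1) / ((1 - t1) * dotp v v).
have t11' : 0 < 1 - t1 by rewrite subr_gt0.
have tau0 : 0 < tau by rewrite divr_gt0 ?mulr_gt0 // ltr_wpDl.
have := E1 (tau *: v); rewrite -conv_hull2 => /le_trans.
move=> /(_ _ (Lambda_hull _ (point_cc _) (point_cc _))).
rewrite !Lambda_point -EFin_max lee_fin le_max /p1 phiC pq !dotpZr.
have -> : q = phi x0 + v by rewrite vE addrC subrK.
have key : tau * ((1 - t1) * dotp v v) = s + 1 by rewrite divfK // mulf_neq0 ?gt_eqF.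
have tv : 0 <= tau * (t1 * dotp v v).
  by apply: mulr_ge0; [exact: ltW|apply: mulr_ge0 => //; exact: ltW].
by rewrite !dotpE => /orP[]; lra.
Qed.

(** Points of [C] give one inequality by monotonicity. For the other, an affine minorant exact at
    [y] has its slope in the image of [C], and dropping the nonnegative [s] only increases it. *)
Lemma Lambda_legendre C : cc C -> Lambda C = legendre (indic_infty (phi @` C)).
Proof.
move=> cC; apply/funext => y; rewrite /legendre /indic_infty.
have termle q : (phi @` C) q -> ((dotp q y)%:E <= Lambda C y)%E.
  move=> [x Cx <-]; rewrite -Lambda_point; apply: Lambda_mono => //.
    exact: point_cc.
  by move=> _ ->.
apply/eqP; rewrite eq_le; apply/andP; split; last first.
  apply: ge_ereal_sup => _ [q _ <-]; case: ifPn => [/set_mem qC|_].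
    by rewrite sube0; exact: termle.
  by rewrite addeNy leNye.
have [C0|CN] := pselect (Lambda C = @ninfty_fun R c).
  by rewrite C0 leNye.
have [f [fE cf f0 _]] := Lambda_fin cC CN.
have [x0 Cx0] : exists x0, C x0.
  apply: contrapT => /forallNP noC; apply: CN; rewrite -Lambda0; congr Lambda.
  by apply/seteqP; split=> // x /noC.
have [q [s [Eq e]]] := conj_epi_subgradient y cC fE cf.
have Cq := conj_epi_slope cC Cx0 Eq.
have s0 := conj_epi_ge0 cC Eq.
apply: (@le_trans _ _ (dotp q y)%:E); first by rewrite fE lee_fin e gerBl.
apply: ereal_sup_ubound; exists q => //.
by rewrite (mem_set Cq) sube0.
Qed.

Lemma Lambda_affine : exists (A : 'M[R]_c) (b : E), A \in unitmx /\
  forall C, cc C -> Lambda C = legendre (indic_infty ((fun x => x *m A + b) @` C)).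
Proof.
have [A Au phiA] := phi_matrix; exists A, (phi 0); split=> // C cC.
rewrite Lambda_legendre //; congr (legendre (indic_infty (_ @` C))).
exact/funext.
Qed.

End empty_to_ninfty.

(** * The case where the empty set has a finite value *)

Section empty_proper.
Hypothesis c1 : (0 < c)%N.
Hypothesis Lambda0 : Lambda set0 <> @ninfty_fun R c.

Let F_ex : exists f : E -> R, [/\ Lambda set0 = EFin \o f, convex_fun f, f 0 = 0 &
  exists B, forall y, f y <= B * \sum_i `|y 0 i|].
Proof. exact: Lambda_fin empty_cc Lambda0. Qed.

Let Epi0 C q s : cc C -> conj_epi set0 q s -> conj_epi C q s.
Proof. by move=> cC; apply: conj_epi_mono => //; exact: empty_cc. Qed.

Let q0_ex : exists q, conj_zero set0 q.
Proof. exact: conj_zero_neq0 empty_cc Lambda0. Qed.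

Let point_fin x : exists f : E -> R,
  [/\ Lambda [set x] = EFin \o f, convex_fun f, f 0 = 0 &
  exists B, forall y, f y <= B * \sum_i `|y 0 i|].
Proof.
have [q Zq] := q0_ex; apply: (@conj_epi_fin _ q 0); first exact: point_cc.
by apply: Epi0 => //; exact: point_cc.
Qed.

Let conj_epi_capT C D q s : cc C -> cc D -> conj_epi C q s -> conj_epi D q s ->
  conj_epi (C `&` D) q s.
Proof.
move=> cC cD; have [q0 Zq0] := q0_ex.
by apply: (conj_epi_cap cC cD (q0 := q0)); exact: Epi0.
Qed.

(** Fixing the value [l] at [y] and the component [b] along [n] cuts the epigraphs in codimension 2.
    If nothing were left over the empty set, [independence] would give [c] independent vectors
    orthogonal to [n]. *)
Let hyperplane_slice (n y : E) (b l : R) x (sg : 'I_c -> R) : n <> 0 ->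
  (forall i, sg i != 0) ->
  (exists q, conj_epi [set x] q (dotp q y - l) /\ dotp n q = b) ->
  (forall i, exists q,
     conj_epi [set x + sg i *: delta_mx 0 i] q (dotp q y - l) /\ dotp n q = b) ->
  exists q, conj_epi set0 q (dotp q y - l) /\ dotp n q = b.
Proof.
move=> n0 sg0 [e Ee] /choice[z zP]; apply: contrapT => /forallNP no0.
pose Zf C : set E := [set q | conj_epi C q (dotp q y - l) /\ dotp n q = b].
have mZ : cap_morphism Zf.
  split.
  - move=> C cC p q t [Ep np] [Eq nq] t0 t1; split.
      have := conj_epi_conv cC Ep Eq t0 t1; congr conj_epi; rewrite !dotpE; ring.
    by rewrite !dotpE np nq; ring.
  - by move=> C D cC cD CD q [Eq nq]; split=> //; exact: conj_epi_mono Eq.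
  - by move=> C D cC cD q [[EC nq] [ED _]]; split=> //; exact: conj_epi_capT.
pose D : 'M[R]_c := \matrix_i (sg i *: delta_mx 0 i).
have rD : row_free D.
  apply: inj_row_free => v; rewrite mulmx_sum_row => vD.
  apply/rowP => i; rewrite mxE.
  have := congr1 (fun w : E => w 0 i) vD; rewrite summxE (bigD1 i) //= big1.
    rewrite rowK !mxE !eqxx mulr1 addr0 => /eqP.
    by rewrite mulf_eq0 (negPf (sg0 i)) orbF => /eqP.
  by move=> j /negPf ji; rewrite rowK !mxE eqxx /= eq_sym ji !mulr0.
have zD i : Zf [set x + row i D] (z i) by rewrite rowK; exact: zP.
have ind := independence mZ no0 rD zD Ee.
pose Rm : 'M[R]_c := \matrix_i (z i - e).
have rR : row_free Rm.
  apply: inj_row_free => v; rewrite mulmx_sum_row => vR.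
  apply/rowP => i; rewrite mxE; apply: ind.
  by rewrite -[RHS]vR; apply: eq_bigr => j _; rewrite rowK.
have : Rm *m n^T = 0.
  apply/row_matrixP => i; rewrite row_mul rowK dotp_mx row0 dotpC !dotpE.
  have [_ nz] := zP i; have [_ ne] := Ee.
  by rewrite nz ne subrr raddf0.
move=> Rn; apply: n0; apply: trmx_inj; rewrite trmx0.
rewrite row_free_unit in rR.
by rewrite -(mulKmx rR n^T) Rn mulmx0.
Qed.

(** A set with convex complement contains, along with [x], one of [x + d] and [x - d]. The
    coordinate directions thus give [c + 1] affinely independent points of [U]. *)
Let spread (U : set E) x : U x ->
  (forall a b w, seg a b w -> U w -> U a \/ U b) ->
  exists sg : 'I_c -> R, forall i, sg i != 0 /\ U (x + sg i *: delta_mx 0 i).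
Proof.
move=> Ux Uc.
suff /choice[sg sgP] : forall i, exists s : R, s != 0 /\ U (x + s *: delta_mx 0 i).
  by exists sg.
move=> i.
have [] := Uc (x + 1 *: delta_mx 0 i) (x + (-1) *: delta_mx 0 i) x _ Ux.
- apply/segP; exists 2^-1; split; [lra|lra|].
  by apply/rowP => j; rewrite !mxE; field.
- by exists 1; rewrite oner_neq0.
- by exists (-1); rewrite oppr_eq0 oner_neq0.
Qed.

Let superlevel_seg (y : E) (l : R) a b w : seg a b w ->
  (l%:E <= Lambda [set w] y)%E ->
  (l%:E <= Lambda [set a] y)%E \/ (l%:E <= Lambda [set b] y)%E.
Proof.
move=> abw /le_trans /(_ (Lambda_seg y abw)).
by rewrite le_max => /orP.
Qed.

(** Otherwise [c + 1] affinely independent points would carry minorants whose slopes have component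
    above [b] along [n]. Mixing them with the zero [q0], of component [b], brings them all to
    component [l], and [hyperplane_slice] contradicts [Fn]. *)
Let slopes_in_hyperplane (n : E) (b : R) : n <> 0 ->
  (forall q s, conj_epi set0 q s -> dotp n q = b) ->
  forall x, (Lambda [set x] n <= b%:E)%E.
Proof.
move=> n0 Fn x; rewrite leNgt; apply/negP => bx.
have [f [fE _ _ _]] := point_fin x.
have [q0 Zq0] := q0_ex.
pose l := f n; have bl : b < l by move: bx; rewrite fE lte_fin.
pose U := [set x | (l%:E <= Lambda [set x] n)%E].
have Ux : U x by rewrite /U /= fE.
have [sg sgP] := spread Ux (@superlevel_seg n l).
have sub z : U z -> exists q s, conj_epi [set z] q s /\ l <= dotp n q.
  move=> Uz; have [g [gE cg _ _]] := point_fin z.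
  have [q [s [Eq e]]] := conj_epi_subgradient n (point_cc z) gE cg.
  exists q, s; split=> //; have := conj_epi_ge0 (point_cc z) Eq.
  by move: Uz; rewrite /U /= gE lee_fin e dotpC; lra.
have [qx [sx [Eqx lx]]] := sub x Ux.
have /choice[qs] : forall i, exists qs : E * R,
    conj_epi [set x + sg i *: delta_mx 0 i] qs.1 qs.2 /\ l <= dotp n qs.1.
  by move=> i; have [q [s ?]] := sub _ (proj2 (sgP i)); exists (q, s).
move=> qsP.
(* Raised to the common height [S], all minorants take the value [- S] at 0, as [hyperplane_slice]
   requires. *)
pose S := sx + \sum_i (qs i).2.
have s0 i : 0 <= (qs i).2 by exact: conj_epi_ge0 (point_cc _) (proj1 (qsP i)).
have sx0 : 0 <= sx by exact: conj_epi_ge0 (point_cc _) Eqx.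
have at_level z q s : conj_epi [set z] q s -> s <= S -> l <= dotp n q ->
    exists q', conj_epi [set z] q' (dotp q' 0 - (- S)) /\ dotp n q' = l.
  move=> Eq sS lq.
  have d0 : 0 < dotp n q - b by lra.
  pose t := (l - b) / (dotp n q - b).
  exists ((1 - t) *: q0 + t *: q); split; last first.
    have tE : t * (dotp n q - b) = l - b by rewrite divfK // gt_eqF.
    by rewrite !dotpE (Fn _ _ Zq0); lra.
  rewrite dotp0r sub0r opprK.
  have -> : S = (1 - t) * S + t * S by ring.
  apply: conj_epi_conv; first exact: point_cc.
  - apply: (@conj_epi_up _ _ 0); first by apply: addr_ge0 => //; exact: sumr_ge0.
    by apply: Epi0 => //; exact: point_cc.
  - exact: conj_epi_up Eq.
  - by apply: divr_ge0; lra.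
  - by rewrite ler_pdivrMr // mul1r; lra.
have [||i|q [Eq nq]] := @hyperplane_slice n 0 l (- S) x sg n0.
- by move=> i; case: (sgP i).
- by apply: at_level Eqx _ lx; rewrite lerDl sumr_ge0.
- have [Ei li] := qsP i; apply: at_level Ei _ li.
  rewrite /S (bigD1 i) //= addrCA lerDl addr_ge0 // sumr_ge0 //.
by have := Fn _ _ Eq; lra.
Qed.

(** Applied to the multiples of [n], [slopes_in_hyperplane] confines the slopes over every point to
    the same hyperplane. Then [hyperplane_slice] yields a minorant of [Lambda set0] whose value at
    [y] is too large. *)
Let points_degenerate (n : E) (b : R) : n <> 0 ->
  (forall q s, conj_epi set0 q s -> dotp n q = b) ->
  forall x y, (Lambda [set x] y <= Lambda set0 y)%E.
Proof.
move=> n0 Fn.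
have slope x q s : conj_epi [set x] q s -> dotp n q = b.
  move=> Eq; have s0 := conj_epi_ge0 (point_cc x) Eq.
  have key t : t * (dotp n q - b) <= s.
    have [->|t0] := eqVneq t 0; first by rewrite mul0r.
    have tn : t *: n <> 0 by move=> /eqP; rewrite scaler_eq0 (negPf t0) => /eqP.
    have tF q' s' : conj_epi set0 q' s' -> dotp (t *: n) q' = t * b.
      by move=> /Fn nq'; rewrite dotpZl nq'.
    have := le_trans (Eq (t *: n)) (slopes_in_hyperplane tn tF x).
    by rewrite lee_fin dotpZr dotpC; lra.
  apply/eqP; rewrite -subr_eq0; apply/negPn/negP => d0.
  have := key ((s + 1) / (dotp n q - b)); rewrite divfK //; lra.
move=> x y; rewrite leNgt; apply/negP => xy.
have [f [fE _ _ _]] := point_fin x; have [f0 [f0E _ _ _]] := F_ex.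
pose l := f y; have bl : f0 y < l by move: xy; rewrite fE f0E lte_fin.
pose U := [set x | (l%:E <= Lambda [set x] y)%E].
have Ux : U x by rewrite /U /= fE.
have [sg sgP] := spread Ux (@superlevel_seg y l).
have sub z : U z -> exists q, conj_epi [set z] q (dotp q y - l) /\ dotp n q = b.
  move=> Uz; have [g [gE cg _ _]] := point_fin z.
  have [q [s [Eq e]]] := conj_epi_subgradient y (point_cc z) gE cg.
  exists q; split; last exact: slope Eq.
  by apply: conj_epi_up Eq; move: Uz; rewrite /U /= gE lee_fin e; lra.
have [|||q [Eq _]] := @hyperplane_slice n y b l x sg n0.
- by move=> i; case: (sgP i).
- exact: sub.
- by move=> i; apply: sub; case: (sgP i).
by have := Eq y; rewrite f0E lee_fin; lra.
Qed.

Let F0 := projT1 (cid F_ex).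

Let F0E : Lambda set0 = EFin \o F0.
Proof. by rewrite /F0; case: cid => f []. Qed.

(* If the slopes of the affine minorants of [Lambda set0] span, then those
   minorants of [Lambda [set x]] which exceed [Lambda set0] at [y] contain one
   whose slope has rational coordinates in a fixed basis. *)
Let rational_slope (A : 'M[R]_c) q0 S : A \in unitmx -> conj_epi set0 q0 S ->
  (forall i, conj_epi set0 (q0 + row i A) S) ->
  forall x y, (Lambda set0 y < Lambda [set x] y)%E ->
  exists (g : 'rV[rat]_c) s, let p := q0 + map_mx ratr g *m A in
    conj_epi [set x] p s /\ ~ conj_epi set0 p s.
Proof.
move=> Au Eq0 Eqi x y; have [f [fE cf _ _]] := point_fin x.
rewrite F0E fE /= lte_fin => xy.
have [q [s [Eq e]]] := conj_epi_subgradient y (point_cc x) fE cf.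
have [S0 s0] := (conj_epi_ge0 empty_cc Eq0, conj_epi_ge0 (point_cc x) Eq).
pose lev (p : E) := dotp p y - S.
pose Mb := `|lev q0| + \sum_i `|lev (q0 + row i A)|.
(* A convex set of slopes containing the simplex with vertices [q0] and [q0 + row i A]; on it the
   minorants of height [S] are bounded below at [y]. *)
pose G : set E := [set p | conj_epi set0 p S /\ - Mb <= lev p].
have cG : cvx G.
  move=> p p' t [Ep lp] [Ep' lp'] t0 t1; split.
    have -> : S = (1 - t) * S + t * S by ring.
    exact: conj_epi_conv empty_cc Ep Ep' t0 t1.
  move: lp lp'; rewrite /lev !dotpE => lp lp'.
  have t1' : 0 <= 1 - t by lra.
  by have := ler_wpM2l t1' lp; have := ler_wpM2l t0 lp'; lra.
have Gq0 : G q0.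
  split=> //; have := ler_norm (- lev q0); rewrite normrN.
  have : 0 <= \sum_i `|lev (q0 + row i A)| by exact: sumr_ge0.
  by rewrite /Mb; lra.
have Gqi i : G (q0 + row i A).
  split=> //; have := ler_norm (- lev (q0 + row i A)); rewrite normrN.
  have : 0 <= \sum_(j | j != i) `|lev (q0 + row j A)| by exact: sumr_ge0.
  have -> : Mb = `|lev q0| + (`|lev (q0 + row i A)| +
      \sum_(j | j != i) `|lev (q0 + row j A)|) by rewrite /Mb (bigD1 i).
  by have := normr_ge0 (lev q0); lra.
have Mb0 : 0 <= Mb by rewrite addr_ge0 // sumr_ge0.
pose d := f y - F0 y.
have d0 : 0 < d by rewrite subr_gt0.
(* Giving weight [ep] to a point of [G] lowers the value at [y] by at most [ep * K], half of the gap
   [d]. *)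
pose K := d + Mb + `|f y| + 1.
have K0 : 0 < K by have := normr_ge0 (f y); rewrite /K; lra.
pose ep := d / (2 * K).
have ep0 : 0 < ep by rewrite divr_gt0 // mulr_gt0.
have epK : ep * K = d / 2 by rewrite /ep; field; rewrite gt_eqF.
have ep1 : ep < 1.
  by rewrite ltr_pdivrMr ?mulr_gt0 // mul1r; have := normr_ge0 (f y); rewrite /K; lra.
have [g0 qE] : exists g0, q = q0 + g0 *m A.
  by exists ((q - q0) *m invmx A); rewrite mulmxKV // addrC subrK.
have c0 : 0 < c%:R :> R by rewrite ltr0n.
(* The rational point lies slightly above [(1 - ep) * g0] in each coordinate. The differences
   divided by [ep] are nonnegative with sum at most 1, hence are weights of a point of the
   simplex. *)
have /choice[r rP] : forall i, exists r : rat,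
    (1 - ep) * g0 0 i < ratr r < (1 - ep) * g0 0 i + ep / c%:R.
  move=> i; have lt : (1 - ep) * g0 0 i < (1 - ep) * g0 0 i + ep / c%:R.
    by rewrite ltrDl divr_gt0.
  by have [r] := rat_in_itvoo lt; rewrite in_itv /=; exists r.
pose be i := (ratr (r i) - (1 - ep) * g0 0 i) / ep.
have be0 i : 0 <= be i.
  apply: divr_ge0; last exact: ltW.
  by rewrite subr_ge0; have /andP[/ltW] := rP i.
have be1 : \sum_i be i <= 1.
  have -> : 1 = \sum_(i < c) c%:R^-1 :> R.
    by rewrite sumr_const card_ord -[RHS]mulr_natl divff // gt_eqF.
  apply: ler_sum => i _; rewrite ler_pdivrMr // mulrC.
  by have /andP[_] := rP i; lra.
pose p2 := q0 + \sum_i be i *: (q0 + row i A - q0).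
have [Ep2 lp2] : G p2 by exact: cvx_sum_base.
exists (\row_i r i), ((1 - ep) * s + ep * S) => /=; set p := q0 + _ *m A.
have pE : p = (1 - ep) *: q + ep *: p2.
  have -> : p2 = q0 + (\row_i be i) *m A.
    rewrite /p2 mulmx_sum_row; congr (_ + _); apply: eq_bigr => i _.
    by rewrite mxE addrAC subrr add0r.
  rewrite qE /p !scalerDr addrACA -scalerDl subrK scale1r !scalemxAl -mulmxDl.
  congr (_ + _ *m _); apply/rowP => i; rewrite !mxE /be.
  by field; rewrite gt_eqF.
rewrite pE; split.
  apply: conj_epi_conv Eq _ (ltW ep0) (ltW ep1); first exact: point_cc.
  by apply: Epi0 => //; exact: point_cc.
move=> /(_ y); rewrite F0E /= lee_fin dotpDl !dotpZl.
have h1 := ler_wpM2l (ltW ep0) lp2.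
have h2 := ler_wpM2l (ltW ep0) (ler_norm (f y)).
move: h1; rewrite /lev => h1 h3.
have h4 : ep * K = ep * d + ep * Mb + ep * `|f y| + ep by rewrite /K; ring.
have h5 : 0 <= ep * d by rewrite mulr_ge0 ?ltW.
have h6 : (1 - ep) * f y + ep * (dotp p2 y - S) <= F0 y by rewrite e; lra.
have dE : d = f y - F0 y by [].
suff : d < d by rewrite ltxx.
lra.
Qed.

(** The heights may differ; the larger one serves both points, hence also the empty intersection.
    But it is one of [s] and [s']. *)
Let minorant_unique p s s' x x' : conj_epi [set x] p s -> ~ conj_epi set0 p s ->
  conj_epi [set x'] p s' -> ~ conj_epi set0 p s' -> x = x'.
Proof.
move=> Es ns Es' ns'; apply: contrapT => xx'.
have E0 : conj_epi set0 p (Num.max s s').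
  have <- : [set x] `&` [set x'] = set0.
    by apply/seteqP; split=> // z [-> e]; case: xx'.
  apply: conj_epi_capT; try exact: point_cc.
    by apply: conj_epi_up Es; rewrite le_max lexx.
  by apply: conj_epi_up Es'; rewrite le_max lexx orbT.
by move: E0; rewrite maxEle; case: ifP.
Qed.

Lemma points_empty x : Lambda [set x] = Lambda set0.
Proof.
apply/funext => y; apply/eqP; rewrite eq_le; apply/andP; split; last first.
  by apply: Lambda_mono; [exact: empty_cc|exact: point_cc|].
have [q0 Zq0] := q0_ex.
(* Either the slopes of the minorants of [Lambda set0] affinely span the space, or they lie in a
   hyperplane. *)
pose V := [set v | exists s, conj_epi set0 (q0 + v) s].
have [[A Au VA]|[n n0 nV]] := basis_or_normal V; last first.
  apply: (points_degenerate (b := dotp n q0) n0) => q s Eq.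
  have := nV (q - q0); rewrite !dotpE => h; apply/eqP; rewrite -subr_eq0.
  by apply/eqP/h; exists s; rewrite addrC subrK.
have /choice[ss ssP] := VA.
pose S := \sum_i `|ss i|.
have S0 : 0 <= S by exact: sumr_ge0.
have EqS : conj_epi set0 q0 S by exact: conj_epi_up Zq0.
have EiS i : conj_epi set0 (q0 + row i A) S.
  apply: conj_epi_up (ssP i); rewrite /S (bigD1 i) //=.
  by apply: le_trans (ler_norm _) _; rewrite lerDl sumr_ge0.
rewrite leNgt; apply/negP => xy.
pose U := [set z | (Lambda set0 y < Lambda [set z] y)%E].
(* Each exceptional point receives a rational code, and [minorant_unique] makes the codes
   distinct. *)
have /choice[g gP] : forall z, exists g : 'rV[rat]_c, U z -> exists s,
    conj_epi [set z] (q0 + map_mx ratr g *m A) s /\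
    ~ conj_epi set0 (q0 + map_mx ratr g *m A) s.
  move=> z; have [Uz|nU] := pselect (U z); last by exists 0.
  by have [g gs] := rational_slope Au EqS EiS Uz; exists g.
have g_inj z z' : U z -> U z' -> g z = g z' -> z = z'.
  move=> /gP[s [Es ns]] /gP[s' [Es' ns']] gg.
  by apply: minorant_unique Es ns _ _; rewrite gg; [exact: Es'|exact: ns'].
pose e : E := delta_mx 0 (Ordinal c1).
have e0 : e != 0.
  apply/eqP => /(congr1 (fun w : E => w 0 (Ordinal c1))); rewrite !mxE !eqxx.
  by move/eqP; rewrite oner_eq0.
(* Since the complement of [U] is convex, [U] contains an open ray from [x]; otherwise [x] would lie
   between two points off [U]. *)
have [sg [sg0 Usg]] : exists sg : R, sg != 0 /\ forall t, 0 < t -> U (x + (t * sg) *: e).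
  apply: contrapT => /forallNP h.
  have bad sg : sg != 0 -> exists2 t, 0 < t & ~ U (x + (t * sg) *: e).
    move=> sg0; apply: contrapT => nt; apply: (h sg); split=> // t t0.
    by apply: contrapT => nU; apply: nt; exists t.
  have [t t0 nt] := bad 1 (oner_neq0 _).
  have [|t' t'0 nt'] := bad (-1); first by rewrite oppr_eq0 oner_neq0.
  have tt : 0 < t + t' by exact: addr_gt0.
  have xs : seg (x + (t * 1) *: e) (x + (t' * -1) *: e) x.
    apply/segP; exists (t / (t + t')); split.
    - by rewrite divr_ge0 // ltW.
    - by rewrite ler_pdivrMr // mul1r lerDl ltW.
    - by apply/rowP => i; rewrite !mxE; field; rewrite gt_eqF.
  have := lt_le_trans xy (Lambda_seg y xs).
  by rewrite lt_max => /orP[].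
(* The codes along the ray inject an interval into a countable type; [t + 1] keeps the parameter
   positive. *)
apply: (@no_injection_itv R _ (fun t => g (x + ((t + 1) * sg) *: e))) => t t'.
rewrite !in_itv /= => /andP[t0 _] /andP[t'0 _] /g_inj.
move=> /(_ (Usg _ _) (Usg _ _)) h; have {h} := h _ _.
rewrite !ltr_wpDl // => /(_ isT isT) /addrI /eqP.
rewrite -subr_eq0 -scalerBl scaler_eq0 (negPf e0) orbF -mulrBl mulf_eq0.
by rewrite (negPf sg0) orbF subr_eq0 => /eqP /addIr.
Qed.

End empty_proper.

End lattice_morphism.

Theorem theorem7p16 (R : realType) (kappa : R) (hkappa : 0 < kappa)
    (c : nat) (hc : (3 <= c)%N)
    (Lambda : set 'rV[R]_c -> ('rV[R]_c -> \bar R))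
    (Lambda_codom : forall C, compact_convex C -> Cvx00_near kappa (Lambda C))
    (Lambda_meet : forall C D, compact_convex C -> compact_convex D ->
       Lambda (C `&` D) = sqcup (Lambda C) (Lambda D))
    (Lambda_join : forall C D, compact_convex C -> compact_convex D ->
       Lambda (conv_hull (C `|` D)) = sqcap (Lambda C) (Lambda D))
    (Lambda_nonconstant : exists C D,
       [/\ compact_convex C, compact_convex D & Lambda C <> Lambda D]) :
  exists phi : 'rV[R]_c -> 'rV[R]_c,
    [/\ is_affine phi, bijective phi &
        forall C, compact_convex C ->
          Lambda C = legendre (indic_infty (phi @` C))].
Proof.
have c2 : (2 <= c)%N by exact: leq_trans hc.
have c1 : (0 < c)%N by exact: leq_trans hc.
(* By [const_points], agreement with the empty set on all points would make [Lambda] constant. *)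
have nonconst : ~ forall x, Lambda [set x] = Lambda set0.
  have [C [D [cC cD CD]]] := Lambda_nonconstant => pts; apply: CD.
  by rewrite !(const_points Lambda_codom Lambda_meet Lambda_join pts).
have [L0|L0] := pselect (Lambda set0 = @ninfty_fun R c); last first.
  by case: nonconst => x; exact: (points_empty Lambda_codom).
have proper : exists x, Lambda [set x] <> @ninfty_fun R c.
  apply: contrapT => /forallNP h; apply: nonconst => x.
  by rewrite L0; apply: contrapT; exact: h.
have [A [b [Au LA]]] :=
  Lambda_affine Lambda_codom Lambda_meet Lambda_join c2 L0 proper.
exists (fun x => x *m A + b); split; last exact: LA.
  by exists (mulmxr A), b.
exists (fun y => (y - b) *m invmx A) => x; first by rewrite addrK mulmxK.
by rewrite mulmxKV // subrK.
Qed.
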